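(* Let $A\in\mathscr{D}\mathrm{iag}$ with $L(A)>0$ and fix an integer $p\in\mathbb{N}$. There are constants $\delta=\delta(A)>0$ and $\bar n=\bar n(A)\in\mathbb{N}$ such that if $B\in\mathrm{SL}_2(\mathbb{R})^k$ is any cocycle with $d(B,A)\le\delta$, then $$\mathbb{P}\Big[\Big|\tfrac1n\log\|B^{(n)}\|-L_n(B)\Big|>n^{-1/5}\Big]\le e^{-n^{\frac1{20p}}}$$ for all scales $n$ with $\bar n\le n\le\big(\log d(B,\mathscr{D}\mathrm{iag})^{-1}\big)^p$.
   Context: $\mathrm{SL}_2(\mathbb{R})$ denotes real $2\times2$ matrices with determinant $\pm1$. $\Sigma=\{1,\dots,k\}$, a probability vector $(p_1,\dots,p_k)$ with positive entries, $X=\Sigma^{\mathbb{Z}}$ with the product probability $\mathbb{P}$ and expectation $\mathbb{E}$; a cocycle $B=(B_1,\dots,B_k)$ has iterates $B^{(n)}(x)=B_{x_{n-1}}\cdots B_{x_0}$ and Lyapunov exponent $L(B)$; $d(A,B)=\max_j\|A_j-B_j\|$. $\mathscr{D}\mathrm{iag}$ is the set of cocycles with two transversal lines invariant under all matrices, $d(B,\mathscr{D}\mathrm{iag})=\inf_{D\in\mathscr{D}\mathrm{iag}}d(B,D)$ (if it is $0$, the upper bound on $n$ is $+\infty$). The finite scale Lyapunov exponent is $L_n(B)=\mathbb{E}[\frac1n\log\|B^{(n)}\|]$. *)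

(* Defs.v *)
From HB Require Import structures.
From mathcomp Require Import all_boot all_order all_algebra.
From mathcomp Require Import all_classical all_reals all_analysis.
Set Implicit Arguments. Unset Strict Implicit. Unset Printing Implicit Defensive.
Import Order.TTheory GRing.Theory Num.Theory numFieldNormedType.Exports.
Local Open Scope classical_set_scope.
Local Open Scope ring_scope.

Section Defs.
Variable R : realType.

Definition vnorm (v : 'cV[R]_2) : R := Num.sqrt (\sum_(i < 2) v i 0 ^+ 2).

Definition opnorm (M : 'M[R]_2) : R :=
  sup [set vnorm (M *m v) | v in [set v : 'cV[R]_2 | vnorm v = 1]].

(* SL_2(R) in the paper's sense: determinant +1 or -1 *)
Definition SL2 (M : 'M[R]_2) : Prop := \det M = 1 \/ \det M = -1.

Definition cocycle (k : nat) := 'I_k -> 'M[R]_2.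
Definition SL2_cocycle (k : nat) (B : cocycle k) : Prop := forall j, SL2 (B j).

Definition cdist (k : nat) (A B : cocycle k) : R :=
  \big[Num.max/0]_(j < k) opnorm (A j - B j).

Definition Diag (k : nat) : set (cocycle k) :=
  [set D | SL2_cocycle D /\
     exists u v : 'cV[R]_2, \det (row_mx u v) != 0 /\
       forall j, (exists a : R, D j *m u = a *: u) /\ (exists b : R, D j *m v = b *: v)].

Definition distDiag (k : nat) (B : cocycle k) : R :=
  inf [set cdist B D | D in @Diag k].

(* B^(n)(x) = B_{x_{n-1}} ... B_{x_0}, for a word x = (x_0,...,x_{n-1}) *)
Definition iterate (k n : nat) (B : cocycle k) (w : {ffun 'I_n -> 'I_k}) : 'M[R]_2 :=
  \prod_(i < n) B (w (rev_ord i)).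

(* Bernoulli weight of the cylinder [x_0 ... x_{n-1} = w] *)
Definition weight (k n : nat) (pr : 'I_k -> R) (w : {ffun 'I_n -> 'I_k}) : R :=
  \prod_(i < n) pr (w i).

Definition Prob (k n : nat) (pr : 'I_k -> R) (E : {ffun 'I_n -> 'I_k} -> bool) : R :=
  \sum_(w : {ffun 'I_n -> 'I_k} | E w) weight pr w.

Definition Expect (k n : nat) (pr : 'I_k -> R) (f : {ffun 'I_n -> 'I_k} -> R) : R :=
  \sum_(w : {ffun 'I_n -> 'I_k}) weight pr w * f w.

Definition Ln (k : nat) (pr : 'I_k -> R) (B : cocycle k) (n : nat) : R :=
  Expect pr (fun w : {ffun 'I_n -> 'I_k} => n%:R^-1 * ln (opnorm (iterate B w))).

Definition Lyap (k : nat) (pr : 'I_k -> R) (B : cocycle k) : R := limn (Ln pr B).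

End Defs.
Arguments Diag {R} k.

(* Main.v *)
Require Import Defs.
From HB Require Import structures.
From mathcomp Require Import all_boot all_order all_algebra.
From mathcomp Require Import all_classical all_reals all_analysis.
From mathcomp Require Import ring lra.
Set Implicit Arguments. Unset Strict Implicit. Unset Printing Implicit Defensive.
Import Order.TTheory GRing.Theory Num.Theory numFieldNormedType.Exports.
Local Open Scope classical_set_scope.
Local Open Scope ring_scope.

(** Pick [D] in [Diag] with [d(B, D) <= 2 exp (- n^(1/p))].  Since [D] is close to the
hyperbolic cocycle [A], it is diagonal, with entries [a_j, b_j], in a basis that is
bounded uniformly in [B]; in this basis [B_j] is a perturbation of size
[exp (- n^(1/p))] of [diag (a_j, b_j)].  Put [S_n = sum_i ln |a_(x_i)|], a random walk
with positive drift, and [q = n^(1/(20p))].  By Chernoff bounds, outside an event of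
probability [exp (- q)] no window of the walk descends by more than [q^2], and [S_n]
is within [n^(4/5) / 6] of its mean.  On the complement the slope [|y|/|x|] of the
orbit of a vector, which is multiplied at each step by [|b/a| = |a|^-2] up to the tiny
perturbation, never exceeds [2 exp (2 q^2)], so that the perturbation stays negligible
along the whole orbit and [ln ||B^(n)|| = S_n + O(q^2)].  Integrating, [L_n(B)] is
itself close to the drift. *)

(** * The entrywise norm on 2x2 matrices *)

Section Matrices.
Variable R : realType.
Implicit Types (M N Q : 'M[R]_2) (v : 'cV[R]_2).

(** Positivity of [L(A)] contracts slopes on average only: a letter may have [|b_j| > |a_j|], so no
    cone need be preserved at each step, and a descending stretch of the walk may amplify a
    perturbation. This is why every window is controlled, and not the full sum alone. The exponents
    are read off in the variable [q]: [n = q^(20p)], [n^(-1/5) = q^(-4p)], and the upper bound on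
    [n] makes the perturbation of order [exp (- q^20)], which beats both the slope [exp (2 q^2)] and
    the number of steps. A descent of size [q^2] has probability [exp (- t q^2)], which absorbs the
    number of windows and still leaves [exp (- q)]. The cocycle [D] varies with [B] and [n], whereas
    the thresholds may not: the drift, the logarithms and the basis of [D] have to be bounded before
    [B] is known. The exponent of [A] is never computed from the drift: zero drift would force
    [L(A) = 0], and a negative drift becomes positive when the two axes are exchanged. *)

Definition sumnorm M : R := `|M 0 0| + `|M 0 1| + `|M 1 0| + `|M 1 1|.

Definition mx2 (a b c d : R) : 'M[R]_2 :=
  \matrix_(i, j) if i == 0 then (if j == 0 then a else b)
                 else (if j == 0 then c else d).

Lemma ord2P (i : 'I_2) : i = 0 \/ i = 1.
Proof.
by case: i => [[|[|//]] hi]; [left|right]; apply/val_inj.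
Qed.

Lemma mx2P M N :
  M 0 0 = N 0 0 -> M 0 1 = N 0 1 -> M 1 0 = N 1 0 -> M 1 1 = N 1 1 -> M = N.
Proof.
move=> h00 h01 h10 h11; apply/matrixP => i j.
by case: (ord2P i) => ->; case: (ord2P j) => ->.
Qed.

Lemma sum_ord2 (F : 'I_2 -> R) : \sum_i F i = F 0 + F 1.
Proof.
rewrite big_ord_recl big_ord1; congr (_ + F _); exact/val_inj.
Qed.

Lemma mul2E (m n : nat) (M : 'M[R]_(m, 2)) (N : 'M[R]_(2, n)) i j :
  (M *m N) i j = M i 0 * N 0 j + M i 1 * N 1 j.
Proof. by rewrite mxE sum_ord2. Qed.

Lemma mx2E a b c d :
  (mx2 a b c d 0 0 = a) * (mx2 a b c d 0 1 = b) *
  (mx2 a b c d 1 0 = c) * (mx2 a b c d 1 1 = d).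
Proof. by rewrite !mxE. Qed.

Lemma sumnorm_ge0 M : 0 <= sumnorm M.
Proof. by rewrite !addr_ge0. Qed.

Lemma le_sumnorm M i j : `|M i j| <= sumnorm M.
Proof.
rewrite /sumnorm; have [] := (normr_ge0 (M 0 0), normr_ge0 (M 0 1)).
have [] := (normr_ge0 (M 1 0), normr_ge0 (M 1 1)).
by case: (ord2P i) => ->; case: (ord2P j) => ->; lra.
Qed.

Lemma sumnormD M N : sumnorm (M + N) <= sumnorm M + sumnorm N.
Proof.
rewrite /sumnorm !mxE.
have h := @ler_normD R R.
have := h (M 0 0) (N 0 0); have := h (M 0 1) (N 0 1).
have := h (M 1 0) (N 1 0); have := h (M 1 1) (N 1 1).
by lra.
Qed.

Lemma sumnormN M : sumnorm (- M) = sumnorm M.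
Proof. by rewrite /sumnorm !mxE !normrN. Qed.

Lemma sumnormM M N : sumnorm (M *m N) <= sumnorm M * sumnorm N.
Proof.
have h i j : `|(M *m N) i j| <= `|M i 0| * `|N 0 j| + `|M i 1| * `|N 1 j|.
  by rewrite mul2E (le_trans (ler_normD _ _)) // !normrM.
have h0 i j i' j' : 0 <= `|M i j| * `|N i' j'| by rewrite mulr_ge0.
rewrite /sumnorm.
have := h 0 0; have := h 0 1; have := h 1 0; have := h 1 1.
have := h0 0 0 1 0; have := h0 0 0 1 1; have := h0 0 1 0 0.
have := h0 0 1 0 1; have := h0 1 0 1 0; have := h0 1 0 1 1.
have := h0 1 1 0 0; have := h0 1 1 0 1.
by lra.
Qed.

Lemma normr_le_vnorm v i : `|v i 0| <= vnorm v.
Proof.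
rewrite -sqrtr_sqr ler_wsqrtr // sum_ord2.
by case: (ord2P i) => ->; rewrite (lerDl, lerDr) sqr_ge0.
Qed.

Lemma vnorm_le v : vnorm v <= `|v 0 0| + `|v 1 0|.
Proof.
rewrite -[leRHS]ger0_norm ?addr_ge0 // -sqrtr_sqr ler_wsqrtr // sum_ord2.
rewrite -(real_normK (num_real (v 0 0))) -(real_normK (num_real (v 1 0))).
have := mulr_ge0 (normr_ge0 (v 0 0)) (normr_ge0 (v 1 0)).
by rewrite sqrrD -mulr_natr; lra.
Qed.

Lemma vnorm_delta (j : 'I_2) : vnorm (delta_mx j 0 : 'cV[R]_2) = 1.
Proof.
rewrite /vnorm sum_ord2 !mxE /=.
by case: (ord2P j) => ->; rewrite /= expr1n expr0n /= ?addr0 ?add0r sqrtr1.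
Qed.

Lemma vnorm_mul_le M v : vnorm v = 1 -> vnorm (M *m v) <= sumnorm M.
Proof.
move=> v1; apply: le_trans (vnorm_le _) _; rewrite !mul2E.
have h0 : `|v 0 0| <= 1 by rewrite -v1 normr_le_vnorm.
have h1 : `|v 1 0| <= 1 by rewrite -v1 normr_le_vnorm.
have h i : `|M i 0 * v 0 0 + M i 1 * v 1 0| <= `|M i 0| + `|M i 1|.
  apply: le_trans (ler_normD _ _) _; rewrite !normrM.
  by apply: lerD; rewrite ler_piMr.
by have := h 0; have := h 1; rewrite /sumnorm; lra.
Qed.

Lemma opnorm_le_sumnorm M : opnorm M <= sumnorm M.
Proof.
apply: ge_sup.
  by exists (vnorm (M *m delta_mx 0 0)), (delta_mx 0 0) => //=; exact: vnorm_delta.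
by move=> _ [v /= v1 <-]; exact: vnorm_mul_le.
Qed.

Lemma normr_le_opnorm M i j : `|M i j| <= opnorm M.
Proof.
have -> : M i j = (M *m (delta_mx j 0 : 'cV_2)) i 0.
  rewrite -colE mxE //.
apply: le_trans (normr_le_vnorm _ _) _.
apply: ub_le_sup; last by exists (delta_mx j 0) => //=; exact: vnorm_delta.
by exists (sumnorm M) => _ [v /= v1 <-]; exact: vnorm_mul_le.
Qed.

Lemma sumnorm_le_opnorm M : sumnorm M <= 4 * opnorm M.
Proof.
have h := normr_le_opnorm M.
have := h 0 0; have := h 0 1; have := h 1 0; have := h 1 1.
by rewrite /sumnorm; lra.
Qed.

Lemma opnorm_ge0 M : 0 <= opnorm M.
Proof. exact: le_trans (normr_ge0 _) (normr_le_opnorm M 0 0). Qed.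

Lemma det2E M : \det M = M 0 0 * M 1 1 - M 0 1 * M 1 0.
Proof.
rewrite (expand_det_row _ 0) sum_ord2 /cofactor !det_mx11 !mxE /=.
rewrite addn0 add0n expr0 expr1 mul1r mulN1r mulrN.
by congr (_ * M _ _ - _ * M _ _); apply/val_inj.
Qed.

(** Entries are bounded by the operator norm, so the determinant is at most twice its square. The
    crude constant is enough to bound [ln (opnorm _)] from below. *)
Lemma opnorm_SL2 M : SL2 M -> 1 / 2 <= opnorm M.
Proof.
move=> hM; have : `|\det M| = 1 by case: hM => ->; rewrite ?normrN normr1.
rewrite det2E => hd; rewrite leNgt; apply/negP => hlt.
have : `|M 0 0 * M 1 1 - M 0 1 * M 1 0| <=
    opnorm M * opnorm M + opnorm M * opnorm M.
  apply: le_trans (ler_normB _ _) _; rewrite !normrM.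
  by apply: lerD; rewrite ler_pM ?normr_le_opnorm.
by rewrite hd; have := opnorm_ge0 M; nra.
Qed.

Lemma opnorm_le_cdist (k : nat) (A B : cocycle R k) j :
  opnorm (A j - B j) <= cdist A B.
Proof. by rewrite /cdist (@le_bigmax _ _ _ _ (fun j => opnorm (A j - B j))). Qed.

Lemma cdist_ge0 (k : nat) (A B : cocycle R k) : 0 <= cdist A B.
Proof.
rewrite /cdist; elim/big_ind : _ => // [x y x0 y0|i _]; last exact: opnorm_ge0.
by rewrite le_max x0.
Qed.

Lemma iterate_SL2 (k n : nat) (B : cocycle R k) (w : {ffun 'I_n -> 'I_k}) :
  SL2_cocycle B -> SL2 (iterate B w).
Proof.
move=> hB; rewrite /iterate; elim/big_ind : _ => [|M N|i _].
- by left; rewrite det1.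
- by case=> hM [] hN; rewrite /SL2 det_mulmx hM hN; [left|right|right|left];
    rewrite ?mulrNN ?mulr1 ?mul1r.
- exact: hB.
Qed.

Lemma iterate_conj (k n : nat) (B : cocycle R k) (w : {ffun 'I_n -> 'I_k}) Q Q' :
  Q' *m Q = 1%:M ->
  iterate (fun j => Q' *m B j *m Q) w = Q' *m iterate B w *m Q.
Proof.
move=> hQ; rewrite /iterate.
rewrite (@big_morph _ _ (fun M => Q' *m M *m Q) 1 *%R 1 *%R) //.
- move=> M N /=; rewrite -!mulmxE !mulmxA; congr (_ *m Q).
  by rewrite -(mulmxA (Q' *m M)) (mulmx1C hQ) mulmx1.
- by rewrite -[1]/(1%:M) mulmx1.
Qed.

(** Partial products indexed by [nat], for inductions along an orbit. The word has length [n.+1] so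
    that [inord] is available; past the end it returns the letter at [0], which does not affect
    [P n.+1]. *)
Lemma iterate_rec (k n : nat) (B : cocycle R k) (w : {ffun 'I_n.+1 -> 'I_k}) :
  exists P : nat -> 'M[R]_2, [/\ P 0%N = 1, P n.+1 = iterate B w &
    forall i, P i.+1 = B (w (inord i)) *m P i].
Proof.
exists (fun m => \prod_(i < m) B (w (inord (m - i.+1)))); split.
- by rewrite big_ord0.
- apply: eq_bigr => i _; congr (B (w _)); apply/val_inj.
  by rewrite /= inordK // subSS ltnS leq_subr.
- move=> i; rewrite big_ord_recl /= subSS subn0 -mulmxE; congr (_ *m _).
Qed.

End Matrices.

(** * Slopes along perturbed diagonal products *)

Section Slope.
Variable R : realType.

Lemma normM1_gt0 (x y : R) : `|x| * `|y| = 1 -> 0 < `|x|.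
Proof.
move=> h; rewrite lt_def normr_ge0 andbT; apply/eqP => x0.
by move: h; rewrite x0 mul0r; lra.
Qed.

Lemma normM1_V (x y : R) : `|x| * `|y| = 1 -> `|y| = `|x|^-1.
Proof.
move=> h; have x0 := lt0r_neq0 (normM1_gt0 h).
by apply: (mulfI x0); rewrite h mulfV.
Qed.

Lemma bernoulli (th : R) (n : nat) : 0 <= th <= 1 -> 1 - n%:R * th <= (1 - th) ^+ n.
Proof.
move=> /andP[th0 th1]; elim: n => [|n IH]; first by rewrite expr0 mul0r subr0.
rewrite exprS -natr1.
have : (1 - th) * (1 - n%:R * th) <= (1 - th) * (1 - th) ^+ n.
  by rewrite ler_wpM2l // subr_ge0.
have : 0 <= n%:R * th * th by rewrite !mulr_ge0.
by lra.
Qed.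

(** Since [|b| / |a| = |a|^-2], the number [W] bounds the growth of the unperturbed slope over every
    window. As long as the slope is at most [2 * W], the hypothesis on [eta] makes each error at
    most a fraction [th] of [|a i * x i|], and [n * th <= 1 / 4] keeps the accumulated relative
    error bounded; the two facts sustain each other by induction. *)
Lemma slope_bound (n : nat) (a b x y : nat -> R) (eta th W : R) :
  (forall i, 0 < `|a i|) -> (forall i, `|a i| * `|b i| = 1) ->
  (forall i, (i < n)%N -> `|x i.+1 - a i * x i| <= eta * (`|x i| + `|y i|)) ->
  (forall i, (i < n)%N -> `|y i.+1 - b i * y i| <= eta * (`|x i| + `|y i|)) ->
  `|x 0%N| = 1 -> `|y 0%N| <= 1 ->
  (forall i l, (i <= l <= n)%N -> \prod_(i <= m < l) (`|a m|^-1 ^+ 2) <= W) ->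
  0 <= eta -> 0 <= th -> n%:R * th <= 1 / 4 -> th <= 1 / 4 ->
  (forall i, eta * (1 + 2 * W) <= th * `|a i|) ->
  `|y n| <= 2 * W * `|x n| /\
  \prod_(0 <= m < n) `|a m| / 2 <= `|x n| <= 2 * \prod_(0 <= m < n) `|a m|.
Proof.
move=> a0 ab hx hy x0 y0 hW eta0 th0 nth th4 heta.
have th1 : 0 < 1 - th by lra.
have hb i : `|b i| = `|a i| * `|a i|^-1 ^+ 2.
  have hane : `|a i| != 0 by rewrite gt_eqF.
  by apply: (mulfI hane); rewrite ab; field.
have W0 : 1 <= W by have := hW 0%N 0%N; rewrite big_geq //; apply.
(* A step multiplies [|x|] by at least [(1 - th) * |a|], so slopes grow by the degraded ratios [r i]
   below, whose window products are at most [V]. As [V <= 4 / 3 * W] and [2 * th * i <= 1 / 2], the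
   bound [V * (1 + 2 * th * i)] never exceeds [2 * W]. *)
pose V := W / (1 - th) ^+ n.
have hpow : 3 / 4 <= (1 - th) ^+ n.
  by have := @bernoulli th n; rewrite th0 /= => /(_ _) h; have := h _; lra.
have pow0 : 0 < (1 - th) ^+ n by lra.
have V0 : 0 < V by rewrite divr_gt0 //; lra.
have hV : V <= 4 / 3 * W.
  by rewrite /V ler_pdivrMr //; nra.
pose r i := `|a i|^-1 ^+ 2 / (1 - th).
have r0 i : 0 < r i by rewrite divr_gt0 // exprn_gt0 // invr_gt0.
have rV i l : (i <= l <= n)%N -> \prod_(i <= m < l) r m <= V.
  move=> /andP[il ln]; rewrite big_split /= prodr_const_nat /V.
  apply: ler_pM; rewrite ?exprn_ge0 ?invr_ge0 ?(ltW th1) //.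
  - by apply: prodr_ge0 => m _; rewrite exprn_ge0 ?invr_ge0.
  - by apply: hW; rewrite il.
  - rewrite -exprVn; apply: ler_weXn2l; last by rewrite (leq_trans (leq_subr _ _)).
    by rewrite -invr1 lef_pV2 ?posrE //; lra.
have R0 i l : 0 <= \prod_(i <= m < l) r m by apply: prodr_ge0 => m _; rewrite ltW.
have nth' i : (i <= n)%N -> i%:R * th <= 1 / 4.
  by move=> hi; apply: le_trans nth; rewrite ler_wpM2r // ler_nat.
(* The bound on the slope [|y i| / |x i|] is multiplied by every later window product:
   this strengthening is what makes the induction on [i] go through. *)
pose Pa i := \prod_(0 <= m < i) `|a m|.
have Pa0 i : 0 < Pa i by apply: prodr_gt0.
have main i : (i <= n)%N ->
  [/\ 0 < `|x i|, (forall l, (i <= l <= n)%N ->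
      `|y i| * \prod_(i <= m < l) r m <= V * (1 + 2 * th * i%:R) * `|x i|),
      (1 - th) ^+ i * Pa i <= `|x i| & (1 - th) ^+ i * `|x i| <= Pa i].
  elim: i => [_|i IH hi].
    rewrite x0 expr0 /Pa big_geq // !mulr1 !mulr0 addr0 mulr1; split => // l hl.
    by apply: le_trans (rV _ _ hl); rewrite ler_piMl.
  have {IH}[xi hyi lo up] := IH (ltnW hi).
  have yi : `|y i| <= 2 * W * `|x i|.
    have := hyi i; rewrite leqnn ltnW // big_geq // mulr1 => /(_ isT) h.
    apply: (le_trans h); rewrite ler_wpM2r //.
    by have := nth' _ (ltnW hi); nra.
  have err : eta * (`|x i| + `|y i|) <= th * `|a i| * `|x i|.
    have : eta * (`|x i| + `|y i|) <= eta * (1 + 2 * W) * `|x i|.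
      by rewrite -mulrA ler_wpM2l //; lra.
    by move=> h; apply: (le_trans h); rewrite ler_wpM2r.
  have hx' := le_trans (hx _ hi) err; have hy' := le_trans (hy _ hi) err.
  have xlo : (1 - th) * `|a i| * `|x i| <= `|x i.+1|.
    have := ler_normB (x i.+1) (x i.+1 - a i * x i).
    by rewrite opprB addrC subrK normrM; lra.
  have xup : `|x i.+1| <= (1 + th) * `|a i| * `|x i|.
    have := ler_normD (x i.+1 - a i * x i) (a i * x i).
    by rewrite subrK normrM; lra.
  have yup : `|y i.+1| <= `|b i| * `|y i| + th * `|a i| * `|x i|.
    have := ler_normD (y i.+1 - b i * y i) (b i * y i).
    by rewrite subrK normrM; lra.
  have PS : Pa i.+1 = Pa i * `|a i| by rewrite /Pa big_nat_recr.
  split.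
  - by apply: lt_le_trans xlo; rewrite !mulr_gt0.
  - move=> l /andP[il ln].
    have hl := hyi l; rewrite (ltnW il) ln big_ltn // in hl.
    have {}hl := hl isT.
    have hl' := rV i.+1 l; rewrite il ln in hl'; have {}hl' := hl' isT.
    have rho0 := R0 i.+1 l.
    set rho := \prod_(i.+1 <= m < l) r m in hl hl' rho0 *.
    have e1 : `|b i| * `|y i| * rho <= V * (1 + 2 * th * i%:R) * `|x i.+1|.
      have -> : `|b i| * `|y i| * rho =
        (1 - th) * `|a i| * (`|y i| * (r i * rho)).
        rewrite hb /r; field.
        by rewrite (gt_eqF th1) (gt_eqF (a0 i)).
      have : (1 - th) * `|a i| * (`|y i| * (r i * rho)) <=
          (1 - th) * `|a i| * (V * (1 + 2 * th * i%:R) * `|x i|).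
        by rewrite ler_wpM2l // mulr_ge0 // ltW.
      move=> h; apply: (le_trans h).
      have c0 : 0 <= V * (1 + 2 * th * i%:R).
        by apply: mulr_ge0; [exact: ltW|rewrite addr_ge0 // !mulr_ge0].
      by have := ler_wpM2l c0 xlo; lra.
    (* The fresh error costs [2 * th * V], exactly the increment of [V * (1 + 2 * th * i)] from [i]
       to [i.+1]. *)
    have e2 : th * `|a i| * `|x i| * rho <= 2 * th * V * `|x i.+1|.
      have h1 : th * `|a i| * `|x i| <= 2 * th * `|x i.+1|.
        have : `|a i| * `|x i| <= 2 * `|x i.+1|.
          have : 0 <= `|a i| * `|x i| by rewrite mulr_ge0.
          by nra.
        by move=> /(ler_wpM2l th0); lra.
      have : th * `|a i| * `|x i| * rho <= 2 * th * `|x i.+1| * V.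
        by apply: ler_pM; rewrite ?mulr_ge0.
      by lra.
    have := ler_wpM2r rho0 yup.
    by rewrite -natr1; lra.
  - rewrite PS exprS.
    have c0 : 0 <= (1 - th) * `|a i| by rewrite mulr_ge0 // ltW.
    by have := ler_wpM2l c0 lo; lra.
  (* [(1 - th) * (1 + th) <= 1] turns the upper factor into an inverse power of [1 - th], so [hpow]
     serves both bounds. *)
  - rewrite PS exprS.
    have h1 : (1 - th) * `|x i.+1| <= `|a i| * `|x i|.
      have := ler_wpM2l (ltW th1) xup.
      have : 0 <= th * th * (`|a i| * `|x i|) by rewrite !mulr_ge0.
      by lra.
    have := ler_wpM2l (exprn_ge0 i (ltW th1)) h1.
    have := ler_wpM2l (ltW (a0 i)) up.
    by lra.
have [xn hyn lo up] := main n (leqnn n).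
split.
  have := hyn n; rewrite leqnn big_geq // mulr1 => /(_ isT) h.
  apply: (le_trans h); rewrite ler_wpM2r //.
  by have := nth; nra.
rewrite -/(Pa n); have P0 := Pa0 n; apply/andP; split; nra.
Qed.
End Slope.

(** * Exponential moments of Bernoulli walks *)

Section Probability.
Variables (R : realType) (k : nat) (pr : 'I_k -> R).
Hypotheses (pr_pos : forall j, 0 < pr j) (pr_sum : \sum_(j < k) pr j = 1).

Lemma weight_ge0 n (w : {ffun 'I_n -> 'I_k}) : 0 <= weight pr w.
Proof. by apply: prodr_ge0 => i _; exact: ltW. Qed.

(** Independence of the letters: on words of finite length it is the distributivity of products over
    sums. *)
Lemma Expect_prod n (f : 'I_n -> 'I_k -> R) :
  Expect pr (fun w : {ffun 'I_n -> 'I_k} => \prod_i f i (w i)) =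
  \prod_i \sum_j pr j * f i j.
Proof. by rewrite bigA_distr_bigA; apply: eq_bigr => w _; rewrite big_split. Qed.

Lemma sum_weight n : \sum_(w : {ffun 'I_n -> 'I_k}) weight pr w = 1.
Proof.
have := Expect_prod (fun (_ : 'I_n) (_ : 'I_k) => 1).
rewrite [RHS]big1 => [<-|i _].
  by apply: eq_bigr => w _; rewrite big1_eq mulr1.
by rewrite -[RHS]pr_sum; apply: eq_bigr => j _; rewrite mulr1.
Qed.

Lemma Expect_cst n (c : R) : Expect pr (fun _ : {ffun 'I_n -> 'I_k} => c) = c.
Proof. by rewrite /Expect -mulr_suml sum_weight mul1r. Qed.

Lemma ExpectD n (f g : {ffun 'I_n -> 'I_k} -> R) :
  Expect pr (fun w => f w + g w) = Expect pr f + Expect pr g.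
Proof. by rewrite /Expect -big_split; apply: eq_bigr => w _; rewrite mulrDr. Qed.

Lemma ExpectZ n (c : R) (f : {ffun 'I_n -> 'I_k} -> R) :
  Expect pr (fun w => c * f w) = c * Expect pr f.
Proof. by rewrite /Expect mulr_sumr; apply: eq_bigr => w _; rewrite mulrCA. Qed.

Lemma Expect_sum n (I : finType) (f : I -> {ffun 'I_n -> 'I_k} -> R) :
  Expect pr (fun w => \sum_i f i w) = \sum_i Expect pr (f i).
Proof.
by rewrite /Expect exchange_big; apply: eq_bigr => w _; rewrite mulr_sumr.
Qed.

Lemma Expect_le n (f g : {ffun 'I_n -> 'I_k} -> R) :
  (forall w, f w <= g w) -> Expect pr f <= Expect pr g.
Proof. by move=> fg; apply: ler_sum => w _; rewrite ler_wpM2l ?weight_ge0. Qed.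

Lemma norm_Expect_le n (f : {ffun 'I_n -> 'I_k} -> R) :
  `|Expect pr f| <= Expect pr (fun w => `|f w|).
Proof.
apply: le_trans (ler_norm_sum _ _ _) _; apply: ler_sum => w _.
by rewrite normrM ger0_norm ?weight_ge0.
Qed.

Lemma Prob_Expect n (E : {ffun 'I_n -> 'I_k} -> bool) :
  Prob pr E = Expect pr (fun w => (E w)%:R).
Proof.
rewrite /Prob /Expect big_mkcond; apply: eq_bigr => w _.
by case: (E w); rewrite ?mulr1 ?mulr0.
Qed.

Lemma Expect_expR n (f : 'I_n -> 'I_k -> R) :
  Expect pr (fun w : {ffun 'I_n -> 'I_k} => expR (\sum_i f i (w i))) =
  \prod_i \sum_j pr j * expR (f i j).
Proof.
by rewrite -Expect_prod; apply: eq_bigr => w _; rewrite expR_sum.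
Qed.

(** From [expR (- z) >= 1 - z] one gets [expR z <= 1 / (1 - z)], and [(1 + z + 2 z^2) (1 - z) = 1 +
    z^2 (1 - 2 z)]. *)
Lemma expR_le_quad (z : R) : z <= 1 / 2 -> expR z <= 1 + z + 2 * z ^+ 2.
Proof.
move=> z2; have h := expR_ge1Dx (- z).
have z1 : 0 < 1 - z by lra.
have : expR z <= (1 - z)^-1.
  by rewrite -[z in expR z]opprK expRN lef_pV2 ?posrE ?expR_gt0.
move=> h'; apply: (le_trans h').
rewrite -[leLHS]mul1r ler_pdivrMr //.
have : 0 <= z ^+ 2 * (1 - 2 * z) by rewrite mulr_ge0 ?sqr_ge0 //; lra.
by lra.
Qed.

Lemma mgf_le (f : 'I_k -> R) (c M : R) :
  (forall j, `|f j| <= M) -> `|c| * M <= 1 / 2 ->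
  \sum_j pr j * expR (c * f j) <=
  1 + c * (\sum_j pr j * f j) + 2 * c ^+ 2 * M ^+ 2.
Proof.
move=> fM cM.
have -> : 1 + c * (\sum_j pr j * f j) + 2 * c ^+ 2 * M ^+ 2 =
  \sum_j pr j * (1 + c * f j + 2 * c ^+ 2 * M ^+ 2).
  rewrite [RHS](eq_bigr (fun j => pr j + c * (pr j * f j) +
    pr j * (2 * c ^+ 2 * M ^+ 2))); last by move=> j _; ring.
  by rewrite !big_split /= -mulr_sumr -mulr_suml pr_sum mul1r.
apply: ler_sum => j _; rewrite ler_wpM2l ?(ltW (pr_pos _)) //.
have hcf : `|c * f j| <= 1 / 2.
  by rewrite normrM (le_trans _ cM) // ler_wpM2l.
apply: le_trans (expR_le_quad _) _.
  by apply: le_trans hcf; exact: ler_norm.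
rewrite lerD2l exprMn -mulrA ler_wpM2l // ler_wpM2l ?sqr_ge0 //.
by rewrite -real_normK ?num_real // ler_sqr ?nnegrE // (le_trans _ (fM j)).
Qed.

Section Walk.
Variables (al : 'I_k -> R) (La : R).
Hypothesis al_le : forall j, `|al j| <= La.
Let mu := \sum_j pr j * al j.

(** Each letter of the window contributes a factor at most [1 - t mu + 2 t^2 La^2], which is at most
    1 when [t] is small against the drift. The bound is thus independent of the length of the
    window, and Markov's inequality gives [exp (- t K)] for a descent by [K]. *)
Lemma window_mgf_le n (W : pred 'I_n) (t : R) :
  0 <= t -> t * La <= 1 / 2 -> 2 * t * La ^+ 2 <= mu ->
  Expect pr (fun w : {ffun 'I_n -> 'I_k} =>
    expR (- t * \sum_(i | W i) al (w i))) <= 1.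
Proof.
move=> t0 tLa tmu.
have -> : (fun w : {ffun 'I_n -> 'I_k} => expR (- t * \sum_(i | W i) al (w i))) =
  (fun w => expR (\sum_i if W i then - t * al (w i) else 0)).
  by apply/funext => w; rewrite mulr_sumr big_mkcond.
rewrite (Expect_expR (fun i j => if W i then - t * al j else 0)).
apply: prodr_ile1 => i _; apply/andP; split.
  by apply: sumr_ge0 => j _; rewrite mulr_ge0 ?expR_ge0 // ltW.
case: (W i); last first.
  by rewrite -[leRHS]pr_sum; apply: ler_sum => j _; rewrite expR0 mulr1.
apply: le_trans (mgf_le al_le _) _; first by rewrite normrN ger0_norm.
rewrite -/mu sqrrN; have := ler_wpM2l t0 tmu; lra.
Qed.

Lemma mean_le : `|mu| <= La.
Proof.
apply: le_trans (ler_norm_sum _ _ _) _.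
rewrite -[La]mul1r -pr_sum mulr_suml; apply: ler_sum => j _.
by rewrite normrM ger0_norm ?(ltW (pr_pos _)) // ler_wpM2l ?(ltW (pr_pos _)).
Qed.

(** Centring removes the linear term, and [8 = 2 * 2^2] because the centred letters are bounded by
    [2 * La]. The sign of [s] is free, which yields both tails. *)
Lemma sum_mgf_le n (s : R) : `|s| * (2 * La) <= 1 / 2 ->
  Expect pr (fun w : {ffun 'I_n -> 'I_k} =>
    expR (s * (\sum_i al (w i) - n%:R * mu))) <= expR (8 * La ^+ 2 * (n%:R * s ^+ 2)).
Proof.
move=> hs.
have -> : (fun w : {ffun 'I_n -> 'I_k} => expR (s * (\sum_i al (w i) - n%:R * mu))) =
  (fun w => expR (\sum_i s * (al (w i) - mu))).
  apply/funext => w; congr expR; rewrite -mulr_sumr big_split /=.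
  by rewrite sumr_const card_ord mulNrn mulr_natl.
rewrite (Expect_expR (fun i j => s * (al j - mu))).
have -> : 8 * La ^+ 2 * (n%:R * s ^+ 2) = \sum_(i < n) (8 * La ^+ 2 * s ^+ 2).
  by rewrite sumr_const card_ord -[RHS]mulr_natl; ring.
rewrite expR_sum; apply: ler_prod => i _; apply/andP; split.
  by apply: sumr_ge0 => j _; rewrite mulr_ge0 ?expR_ge0 // ltW.
have hb j : `|al j - mu| <= 2 * La.
  by apply: le_trans (ler_normB _ _) _; have := al_le j; have := mean_le; lra.
apply: le_trans (mgf_le hb hs) _; apply: le_trans _ (expR_ge1Dx _).
have -> : \sum_j pr j * (al j - mu) = 0.
  under eq_bigr do rewrite mulrBr.
  by rewrite big_split /= sumrN -mulr_suml pr_sum mul1r subrr.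
by rewrite mulr0 addr0 lerD2l; lra.
Qed.

(** Window ends range over ['I_n.+1] so that a window may reach the last letter. Empty windows are
    included, hence a regular word can exist only if [K >= 0]. *)
Definition regular n (K T : R) (w : {ffun 'I_n -> 'I_k}) : bool :=
  [forall i : 'I_n.+1, forall l : 'I_n.+1,
     - (\sum_(m < n | (i <= m < l)%N) al (w m)) <= K]
  && (`|\sum_i al (w i) - n%:R * mu| <= T).

(** Markov's inequality and the union bound at once: the indicator of irregularity is dominated by
    [g], a sum of exponentials over all windows and both tails, one of which is at least 1 at any
    irregular word. *)
Lemma Prob_irregular n (K T s t : R) :
  0 <= t -> t * La <= 1 / 2 -> 2 * t * La ^+ 2 <= mu ->
  0 <= s -> s * (2 * La) <= 1 / 2 ->
  Prob pr (fun w : {ffun 'I_n -> 'I_k} => ~~ regular K T w) <=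
  (n.+1)%:R ^+ 2 * expR (- (t * K)) +
  2 * expR (8 * La ^+ 2 * (n%:R * s ^+ 2) - s * T).
Proof.
move=> t0 tLa tmu s0 sLa.
pose D (w : {ffun 'I_n -> 'I_k}) := \sum_i al (w i) - n%:R * mu.
pose g (w : {ffun 'I_n -> 'I_k}) :=
  \sum_(il : 'I_n.+1 * 'I_n.+1) expR (- (t * K)) *
     expR (- t * \sum_(m < n | (il.1 <= m < il.2)%N) al (w m)) +
  (expR (- (s * T)) * expR (s * D w) + expR (- (s * T)) * expR (- s * D w)).
apply: (@le_trans _ _ (Expect pr g)).
  rewrite Prob_Expect; apply: Expect_le => w.
  have g1 : 0 <= \sum_(il : 'I_n.+1 * 'I_n.+1) expR (- (t * K)) *
     expR (- t * \sum_(m < n | (il.1 <= m < il.2)%N) al (w m)).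
    by apply: sumr_ge0 => il _; rewrite mulr_ge0 ?expR_ge0.
  have g2 : 0 <= expR (- (s * T)) * expR (s * D w) by rewrite mulr_ge0 ?expR_ge0.
  have g3 : 0 <= expR (- (s * T)) * expR (- s * D w) by rewrite mulr_ge0 ?expR_ge0.
  case: (boolP (regular K T w)) => [_|]; first by rewrite !addr_ge0.
  rewrite negb_and => /orP[/forallPn[i /forallPn[l]]|].
    rewrite -ltNge => hil; rewrite /= -[leLHS]addr0 lerD ?addr_ge0 //.
    rewrite (bigD1 (i, l)) //= -[leLHS]addr0 lerD //; last first.
      by apply: sumr_ge0 => il _; rewrite mulr_ge0 ?expR_ge0.
    rewrite -expRD -expR0 ler_expR.
    by have := ler_wpM2l t0 (ltW hil); lra.
  rewrite -ltNge -/(D w) => hD; rewrite /= -[leLHS]add0r lerD //.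
  have [d0|d0] := leP 0 (D w).
    rewrite -[leLHS]addr0 lerD // -expRD -expR0 ler_expR.
    rewrite ger0_norm // in hD.
    by have := ler_wpM2l s0 (ltW hD); lra.
  rewrite -[leLHS]add0r lerD // -expRD -expR0 ler_expR.
  rewrite ltr0_norm // in hD.
  by have := ler_wpM2l s0 (ltW hD); lra.
rewrite /g 2!ExpectD !ExpectZ; apply: lerD.
  rewrite Expect_sum -natrX.
  have -> : (n.+1 ^ 2)%:R * expR (- (t * K)) =
      \sum_(il : 'I_n.+1 * 'I_n.+1) expR (- (t * K)).
    by rewrite sumr_const card_prod card_ord mulr_natl.
  apply: ler_sum => il _; rewrite ExpectZ ler_piMr ?expR_ge0 //.
  exact: (@window_mgf_le n (fun m => (il.1 <= m < il.2)%N)).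
rewrite expRD -/D.
have h1 : Expect pr (fun w : {ffun 'I_n -> 'I_k} => expR (s * D w)) <=
   expR (8 * La ^+ 2 * (n%:R * s ^+ 2)).
  by apply: sum_mgf_le; rewrite ger0_norm.
have h2 : Expect pr (fun w : {ffun 'I_n -> 'I_k} => expR (- s * D w)) <=
   expR (8 * La ^+ 2 * (n%:R * s ^+ 2)).
  by rewrite -[s ^+ 2]sqrrN; apply: sum_mgf_le; rewrite normrN ger0_norm.
have := ler_wpM2l (expR_ge0 (- (s * T))) h1.
have := ler_wpM2l (expR_ge0 (- (s * T))) h2.
lra.
Qed.

End Walk.

(** Concentration around a number [m] implies concentration around the mean: the exceptional event
    moves the mean by at most [C * pi <= tau], so [m] is within [2 * tau] of the mean, and a
    deviation beyond [3 * tau] can occur only off [G]. *)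
Lemma deviation_transfer n (f : {ffun 'I_n -> 'I_k} -> R)
    (G : {ffun 'I_n -> 'I_k} -> bool) (m C tau pi : R) :
  0 <= tau -> 0 <= C ->
  (forall w, G w -> `|f w - m| <= tau) -> (forall w, `|f w - m| <= C) ->
  Prob pr (fun w => ~~ G w) <= pi -> C * pi <= tau ->
  Prob pr (fun w => `|f w - Expect pr f| > 3 * tau) <= pi.
Proof.
move=> tau0 C0 hG hC hpi hCpi.
have hE : `|Expect pr f - m| <= 2 * tau.
  have -> : Expect pr f - m = Expect pr (fun w => f w - m).
    by rewrite (ExpectD f (fun=> - m)) Expect_cst.
  apply: le_trans (norm_Expect_le _) _.
  apply: (@le_trans _ _ (Expect pr (fun w => tau + C * (~~ G w)%:R))).
    apply: Expect_le => w; case: (boolP (G w)) => hw /=.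
      by rewrite mulr0 addr0 hG.
    by rewrite mulr1 (le_trans (hC w)) // lerDr.
  rewrite (ExpectD (fun=> tau)) Expect_cst ExpectZ -Prob_Expect.
  by have := ler_wpM2l C0 hpi; lra.
apply: le_trans hpi; rewrite !Prob_Expect; apply: Expect_le => w.
rewrite ler_nat; case: ltP => // hlt; case: (boolP (G w)) => // /hG hw.
have := ler_normB (f w - m) (Expect pr f - m).
have -> : f w - m - (Expect pr f - m) = f w - Expect pr f by ring.
by lra.
Qed.

End Probability.

(** * Invariant lines of perturbed hyperbolic cocycles *)

Section DiagonalBases.
Variable R : realType.
Implicit Types (M N P H : 'M[R]_2) (u v : 'cV[R]_2).

Lemma row_mx_mx2 u v : row_mx u v = mx2 (u 0 0) (v 0 0) (u 1 0) (v 1 0).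
Proof.
have h0 (i : 'I_2) : (row_mx u v : 'M[R]_2) i 0 = u i 0 
  by rewrite -(row_mxEl u v); congr (row_mx u v _ _); exact/val_inj.
have h1 (i : 'I_2) : (row_mx u v : 'M[R]_2) i 1 = v i 0 
  by rewrite -(row_mxEr u v); congr (row_mx u v _ _); exact/val_inj.
by apply: mx2P; rewrite ?h0 ?h1 !mx2E.
Qed.

Lemma normr_det_SL2 M : SL2 M -> `|\det M| = 1.
Proof. by case=> ->; rewrite ?normrN normr1. Qed.

Lemma det_eigenbasis H u v la lb :
  \det (row_mx u v) != 0 -> H *m u = la *: u -> H *m v = lb *: v ->
  \det H = la * lb.
Proof.
rewrite row_mx_mx2; set M := mx2 _ _ _ _ => dM hu hv.
have hM : H *m M = M *m mx2 la 0 0 lb.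
  have hu' i := congr1 (fun x : 'cV[R]_2 => x i 0) hu.
  have hv' i := congr1 (fun x : 'cV[R]_2 => x i 0) hv.
  have := hu' 0; have := hu' 1; have := hv' 0; have := hv' 1.
  rewrite !mul2E !mxE /= => h1 h2 h3 h4.
  by apply: mx2P; rewrite !mul2E !mx2E; lra.
apply: (mulIf dM); rewrite -det_mulmx hM det_mulmx mulrC; congr (_ * _).
by rewrite det2E !mx2E mulr0 subr0.
Qed.

Lemma Diag_diagonalize (k : nat) (A : cocycle R k) : Diag k A ->
  exists (P P' : 'M[R]_2) (a b : 'I_k -> R), [/\ P' *m P = 1%:M,
    (forall j, P' *m A j *m P = mx2 (a j) 0 0 (b j)) &
    (forall j, `|a j| * `|b j| = 1)].
Proof.
move=> [hA [u [v [huv h]]]].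
have [a ha] := choice (fun j => (h j).1).
have [b hb] := choice (fun j => (h j).2).
have huv' := huv; rewrite row_mx_mx2 in huv'.
set P := mx2 _ _ _ _ in huv'.
have PU : P \in unitmx by rewrite unitmxE unitfE.
exists P, (invmx P), a, b; split => [|j|j].
- by rewrite mulVmx.
- rewrite -mulmxA -[RHS](mulKmx PU); congr (_ *m _).
  have hu' i := congr1 (fun x : 'cV[R]_2 => x i 0) (ha j).
  have hv' i := congr1 (fun x : 'cV[R]_2 => x i 0) (hb j).
  have := hu' 0; have := hu' 1; have := hv' 0; have := hv' 1.
  rewrite !mul2E !mxE /= => h1 h2 h3 h4.
  by apply: mx2P; rewrite !mul2E !mx2E; lra.
- by rewrite -normrM -(det_eigenbasis huv (ha j) (hb j)) normr_det_SL2.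
Qed.

Lemma eigenvalue_near (h00 h01 a e lam x y : R) :
  `|h00 - a| + `|h01| <= e -> x != 0 -> `|y| <= `|x| ->
  h00 * x + h01 * y = lam * x -> `|lam - a| <= e.
Proof.
move=> he x0 yx hl.
have xp : 0 < `|x| by rewrite normr_gt0.
rewrite -(ler_pM2r xp) -normrM.
have -> : (lam - a) * x = (h00 - a) * x + h01 * y by rewrite mulrBl -hl; ring.
apply: le_trans (ler_normD _ _) _; rewrite !normrM.
have := ler_wpM2l (normr_ge0 h01) yx.
have := ler_wpM2r (normr_ge0 x) he.
by lra.
Qed.

(** The first row puts [lam] near [a], hence at distance at least [9 * e] from [b]; the second row
    then gives [9 * e * |y| <= e * |x|]. The gap thus improves the mere choice of the larger
    coordinate to a narrow cone about the axis. *)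
Lemma eigenvector_near (h00 h01 h10 h11 a b e lam x y : R) :
  `|h00 - a| + `|h01| <= e -> `|h10| + `|h11 - b| <= e ->
  0 < e -> 10 * e <= `|a - b| -> x != 0 -> `|y| <= `|x| ->
  h00 * x + h01 * y = lam * x -> h10 * x + h11 * y = lam * y ->
  `|lam - a| <= e /\ 4 * `|y| <= `|x|.
Proof.
move=> he he' e0 eab x0 yx hl hl'.
have hla := eigenvalue_near he x0 yx hl; split => //.
have h1 : `|lam - b| * `|y| <= e * `|x|.
  rewrite -normrM.
  have -> : (lam - b) * y = h10 * x + (h11 - b) * y by rewrite mulrBl -hl'; ring.
  apply: le_trans (ler_normD _ _) _; rewrite !normrM.
  have := ler_wpM2l (normr_ge0 (h11 - b)) yx.
  have := ler_wpM2r (normr_ge0 x) he'.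
  by lra.
have h2 : 9 * e <= `|lam - b|.
  have := ler_normB (lam - b) (lam - a).
  by have -> : lam - b - (lam - a) = a - b by [ring]; lra.
have h3 := ler_wpM2r (normr_ge0 y) h2.
rewrite -(ler_pM2l e0); have := normr_ge0 y; nra.
Qed.

(** Otherwise [a ^+ 2] would be close to a number of modulus 1, against the gap. This prevents both
    invariant lines of a hyperbolic letter from lying near the same axis. *)
Lemma eigenvalues_not_both_near (a e la lb : R) :
  `|la * lb| = 1 -> 0 < e <= 1 -> e * (2 * `|a| + 1) < `| `|a| ^+ 2 - 1| ->
  `|la - a| <= e -> `|lb - a| <= e -> False.
Proof.
move=> hlb /andP[e0 e1] hgap ha hb.
have h1 : `| `|a| ^+ 2 - 1| <= `|a ^+ 2 - la * lb|.
  by rewrite -hlb -normrX ler_dist_dist.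
have h2 : a ^+ 2 - la * lb = - (la * (lb - a) + a * (la - a)) by ring.
have h3 : `|la| <= `|a| + e.
  by have := ler_normD (la - a) a; rewrite subrK; lra.
have : `|a ^+ 2 - la * lb| <= `|la| * `|lb - a| + `|a| * `|la - a|.
  by rewrite h2 normrN (le_trans (ler_normD _ _)) // !normrM.
have := ler_pM (normr_ge0 _) (normr_ge0 _) h3 hb.
have := ler_wpM2l (normr_ge0 a) ha.
by have := normr_ge0 a; nra.
Qed.

(** The bounds 4 and 8 are absolute, which is what makes the basis uniform over all nearby diagonal
    cocycles. *)
Definition near_eigenbasis (k : nat) (H : 'I_k -> 'M[R]_2) (a : 'I_k -> R) (e : R) :=
  exists (G G' : 'M[R]_2) (a' b' : 'I_k -> R),
    [/\ G' *m G = 1%:M, sumnorm G <= 4, sumnorm G' <= 8 &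
     forall j, [/\ G' *m H j *m G = mx2 (a' j) 0 0 (b' j),
       `|a' j| * `|b' j| = 1 & `|a' j - a j| <= e]].

(** The invariant lines are spanned by [(1, y)] and [(z, 1)] with [|y|, |z| <= 1 / 4]; the
    determinant [1 - y * z] is at least [15 / 16], so the matrix with these columns and its inverse
    are bounded. *)
Lemma near_eigenbasis_of_axes (k : nat) (H : 'I_k -> 'M[R]_2) (a b a' b' : 'I_k -> R)
    (e : R) u v :
  (forall j, sumnorm (H j - mx2 (a j) 0 0 (b j)) <= e) ->
  (forall j, SL2 (H j)) -> \det (row_mx u v) != 0 ->
  (forall j, H j *m u = a' j *: u) -> (forall j, H j *m v = b' j *: v) ->
  u 0 0 != 0 -> v 1 0 != 0 ->
  4 * `|u 1 0| <= `|u 0 0| -> 4 * `|v 0 0| <= `|v 1 0| ->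
  near_eigenbasis H a e.
Proof.
move=> he hS huv hu hv u0 v1 hu4 hv4.
pose y := u 1 0 / u 0 0; pose z := v 0 0 / v 1 0.
have yle : `|y| <= 1 / 4.
  by rewrite normf_div ler_pdivrMr ?normr_gt0 //; lra.
have zle : `|z| <= 1 / 4.
  by rewrite normf_div ler_pdivrMr ?normr_gt0 //; lra.
have yz : `|y * z| <= 1 / 16.
  rewrite normrM; have := ler_pM (normr_ge0 _) (normr_ge0 _) yle zle; lra.
have yz' := le_trans (ler_norm _) yz.
have d0 : 1 - y * z != 0 by rewrite gt_eqF //; lra.
pose d := (1 - y * z)^-1.
have dle : `|d| <= 16 / 15.
  have h : 15 / 16 <= `|1 - y * z| by rewrite ger0_norm; lra.
  have h0 : 0 < `|1 - y * z| by rewrite normr_gt0.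
  by rewrite normfV -[leLHS]mul1r ler_pdivrMr //; lra.
have heig j : [/\ H j 0 0 * u 0 0 + H j 0 1 * u 1 0 = a' j * u 0 0,
    H j 1 0 * u 0 0 + H j 1 1 * u 1 0 = a' j * u 1 0,
    H j 0 0 * v 0 0 + H j 0 1 * v 1 0 = b' j * v 0 0 &
    H j 1 0 * v 0 0 + H j 1 1 * v 1 0 = b' j * v 1 0].
  have hu' i := congr1 (fun x : 'cV[R]_2 => x i 0) (hu j).
  have hv' i := congr1 (fun x : 'cV[R]_2 => x i 0) (hv j).
  have := hu' 0; have := hu' 1; have := hv' 0; have := hv' 1.
  by rewrite !mul2E !mxE.
have hG : mx2 d (- (d * z)) (- (d * y)) d *m mx2 1 z y 1 = 1%:M.
  by apply: mx2P; rewrite !mul2E !mx2E !mxE /= /d; field.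
exists (mx2 1 z y 1), (mx2 d (- (d * z)) (- (d * y)) d), a', b'; split => // [||j].
- by rewrite /sumnorm !mx2E normr1; lra.
- rewrite /sumnorm !mx2E !normrN (normrM d y) (normrM d z).
  have := ler_pM (normr_ge0 _) (normr_ge0 _) dle yle.
  have := ler_pM (normr_ge0 _) (normr_ge0 _) dle zle.
  by lra.
have [e1 e2 e3 e4] := heig j; split.
- rewrite -mulmxA.
  have -> : H j *m mx2 1 z y 1 = mx2 1 z y 1 *m mx2 (a' j) 0 0 (b' j).
    apply: mx2P; rewrite !mul2E !mx2E ?(mulr0, mulr1, mul1r, addr0, add0r).
    + by apply: (mulIf u0); rewrite -e1 /y; field.
    + by apply: (mulIf v1); transitivity (b' j * v 0 0); [rewrite -e3|]; rewrite /z; field.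
    + by apply: (mulIf u0); transitivity (a' j * u 1 0); [rewrite -e2|]; rewrite /y; field.
    + by apply: (mulIf v1); rewrite -e4 /z; field.
  by rewrite mulmxA hG mul1mx.
- by rewrite -normrM -(det_eigenbasis huv (hu j) (hv j)) normr_det_SL2.
- have := he j; rewrite /sumnorm !mxE /= !subr0 => hj.
  apply: (@eigenvalue_near (H j 0 0) (H j 0 1) _ _ _ (u 0 0) (u 1 0)) => //.
    by have := normr_ge0 (H j 1 0); have := normr_ge0 (H j 1 1 - b j); lra.
  by have := normr_ge0 (u 1 0); lra.
Qed.

Lemma det_row_mxC u v : \det (row_mx u v) != 0 -> \det (row_mx v u) != 0.
Proof.
rewrite !row_mx_mx2 !det2E !mx2E -oppr_eq0; congr (_ != 0); ring.
Qed.

(** One hyperbolic letter [j0] locates the common lines: each is near an axis by the gap between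
    [a j0] and [b j0], and the two axes differ by the determinant. The other letters share these
    lines, so their eigenvalues are near the unperturbed ones with no gap assumed for them. *)
Lemma hyperbolic_eigenbasis (k : nat) (H : 'I_k -> 'M[R]_2) (a b : 'I_k -> R) (e : R)
    (j0 : 'I_k) u v :
  (forall j, sumnorm (H j - mx2 (a j) 0 0 (b j)) <= e) ->
  (forall j, SL2 (H j)) -> \det (row_mx u v) != 0 ->
  (forall j, exists l, H j *m u = l *: u) -> (forall j, exists l, H j *m v = l *: v) ->
  0 < e <= 1 -> 10 * e <= `|a j0 - b j0| ->
  e * (2 * `|a j0| + 1) < `| `|a j0| ^+ 2 - 1| ->
  e * (2 * `|b j0| + 1) < `| `|b j0| ^+ 2 - 1| ->
  near_eigenbasis H a e.
Proof.
move=> he hS huv /choice[lu hu] /choice[lv hv] e01 eab ea eb.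
have e0 : 0 < e by case/andP: e01.
have axis (x : 'cV[R]_2) l : x != 0 -> H j0 *m x = l *: x ->
    [/\ x 0 0 != 0, 4 * `|x 1 0| <= `|x 0 0| & `|l - a j0| <= e] \/
    [/\ x 1 0 != 0, 4 * `|x 0 0| <= `|x 1 0| & `|l - b j0| <= e].
  move=> x0 hx.
  have hx' i := congr1 (fun x : 'cV[R]_2 => x i 0) hx.
  have := hx' 0; have := hx' 1; rewrite !mul2E !mxE => h1 h0.
  have := he j0; rewrite /sumnorm !mxE /= !subr0 => hj.
  have p0 := normr_ge0 (H j0 0 0 - a j0); have p1 := normr_ge0 (H j0 0 1).
  have p2 := normr_ge0 (H j0 1 0); have p3 := normr_ge0 (H j0 1 1 - b j0).
  have nz : `|x 1 0| <= `|x 0 0| -> x 0 0 != 0.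
    move=> hle; apply: contra x0 => /eqP x00; rewrite x00 normr0 normr_le0 in hle.
    apply/eqP/matrixP => i j; rewrite ord1 mxE.
    by case: (ord2P i) => -> //; exact/eqP.
  have nz' : `|x 0 0| <= `|x 1 0| -> x 1 0 != 0.
    move=> hle; apply: contra x0 => /eqP x00; rewrite x00 normr0 normr_le0 in hle.
    apply/eqP/matrixP => i j; rewrite ord1 mxE.
    by case: (ord2P i) => -> //; exact/eqP.
  have [hle|hlt] := leP `|x 1 0| `|x 0 0|; [left|right].
    have [] := @eigenvector_near (H j0 0 0) (H j0 0 1) (H j0 1 0) (H j0 1 1)
      (a j0) (b j0) e l (x 0 0) (x 1 0) _ _ e0 eab (nz hle) hle h0 h1.
    - by lra.
    - by lra.
    by split => //; exact: nz.
  have hle := ltW hlt.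
  have [] := @eigenvector_near (H j0 1 1) (H j0 1 0) (H j0 0 1) (H j0 0 0)
    (b j0) (a j0) e l (x 1 0) (x 0 0) _ _ e0 _ (nz' hle) hle _ _.
  - by lra.
  - by lra.
  - by rewrite distrC.
  - by rewrite addrC.
  - by rewrite addrC.
  by split => //; exact: nz'.
have u0 : u != 0.
  by apply: contra huv => /eqP ->; rewrite row_mx_mx2 det2E !mxE /= !mul0r mulr0 subrr.
have v0 : v != 0.
  by apply: contra huv => /eqP ->; rewrite row_mx_mx2 det2E !mxE /= !mulr0 mul0r subrr.
have hl : `|lu j0 * lv j0| = 1.
  by rewrite -(det_eigenbasis huv (hu j0) (hv j0)) normr_det_SL2.
case: (axis u _ u0 (hu j0)) => [] [un u4 ul]; case: (axis v _ v0 (hv j0)) => [] [vn v4 vl].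
- by case: (eigenvalues_not_both_near hl e01 ea ul vl).
- exact: (near_eigenbasis_of_axes he hS huv hu hv).
- exact: (near_eigenbasis_of_axes he hS (det_row_mxC huv) hv hu).
- by case: (eigenvalues_not_both_near hl e01 eb ul vl).
Qed.

End DiagonalBases.

(** * Growth of the iterates on the regular event *)

Section Growth.
Variables (R : realType) (k : nat).

Lemma sumnorm1 : sumnorm (1 : 'M[R]_2) = 2.
Proof. by rewrite /sumnorm !mxE /= normr0 normr1; lra. Qed.

Lemma sumnorm_iterate_le n (B : cocycle R k) (w : {ffun 'I_n -> 'I_k}) (C : R) :
  0 <= C -> (forall j, sumnorm (B j) <= C) -> sumnorm (iterate B w) <= 2 * C ^+ n.
Proof.
move=> C0 hB; rewrite /iterate.
elim: n w => [|n IH] w; first by rewrite big_ord0 sumnorm1 expr0 mulr1.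
(* The leading factor carries the last letter; the remaining ones form the iterate along the first
   [n] letters. *)
pose w' : {ffun 'I_n -> 'I_k} := [ffun i => w (widen_ord (leqnSn n) i)].
rewrite big_ord_recl /= -mulmxE; apply: le_trans (sumnormM _ _) _.
rewrite exprS mulrCA; apply: ler_pM; rewrite ?sumnorm_ge0 //.
have := IH w'; congr (sumnorm _ <= _); apply: eq_bigr => i _; rewrite ffunE.
by congr (B (w _)); apply/val_inj; rewrite /= /bump /= add1n subSS.
Qed.

(** The a priori bound on all words, needed to control the contribution of the irregular ones to the
    mean. *)
Lemma ln_opnorm_iterate_le n (B : cocycle R k) (w : {ffun 'I_n -> 'I_k}) (C : R) :
  1 <= C -> SL2_cocycle B -> (forall j, sumnorm (B j) <= C) ->
  `|ln (opnorm (iterate B w))| <= ln 2 + n%:R * ln C.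
Proof.
move=> C1 hS hB.
have C0 : 0 < C by lra.
have o2 := opnorm_SL2 (iterate_SL2 w hS).
have o0 : 0 < opnorm (iterate B w) by lra.
have l0 : 0 <= ln C by exact: ln_ge0.
rewrite ler_norml; apply/andP; split.
  have : ln (1 / 2) <= ln (opnorm (iterate B w)) by rewrite ler_ln ?posrE //; lra.
  rewrite mul1r lnV ?posrE //.
  by have : 0 <= n%:R * ln C by [rewrite mulr_ge0]; lra.
have h := le_trans (opnorm_le_sumnorm _) (sumnorm_iterate_le w (ltW C0) hB).
have := h; rewrite -ler_ln ?posrE ?mulr_gt0 ?exprn_gt0 //.
by rewrite lnM ?posrE ?exprn_gt0 // lnXn // mulr_natl.
Qed.

Lemma expR_sum_ln (I : Type) (r : seq I) (P : pred I) (f : I -> R) :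
  (forall i, 0 < f i) -> expR (\sum_(i <- r | P i) ln (f i)) = \prod_(i <- r | P i) f i.
Proof.
by move=> f0; rewrite expR_sum; apply: eq_bigr => i _; rewrite lnK // posrE.
Qed.

(** In the basis [Q] the columns of the iterate are orbits to which the slope estimate applies, with
    [W = expR (2 * K)] because [|a|^-2 = expR (- 2 * ln |a|)]. Changing basis costs a factor
    [C ^+ 2] in each direction. *)
Lemma ln_opnorm_iterate_near n (B : cocycle R k) (w : {ffun 'I_n.+1 -> 'I_k})
    (Q Q' : 'M[R]_2) (a b : 'I_k -> R) (C eta th K : R) :
  Q' *m Q = 1%:M -> 1 <= C -> sumnorm Q <= C -> sumnorm Q' <= C ->
  (forall j, `|a j| * `|b j| = 1) ->
  (forall j, sumnorm (Q' *m B j *m Q - mx2 (a j) 0 0 (b j)) <= eta) ->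
  (forall i l : 'I_n.+2, - (\sum_(m < n.+1 | (i <= m < l)%N) ln `|a (w m)|) <= K) ->
  0 <= eta -> 0 <= th -> n.+1%:R * th <= 1 / 4 ->
  (forall j, eta * (1 + 2 * expR (2 * K)) <= th * `|a j|) ->
  `|ln (opnorm (iterate B w)) - \sum_i ln `|a (w i)| | <= ln (18 * C ^+ 2) + 2 * K.
Proof.
move=> hQ C1 hC hC' hab hB hK eta0 th0 hth heta.
have C0 : 0 < C by lra.
have K0 : 0 <= K by have := hK ord0 ord0; rewrite big_pred0 ?oppr0.
have th4 : th <= 1 / 4.
  by apply: le_trans hth; rewrite ler_peMl // ler1n.
have a0 j : 0 < `|a j| := normM1_gt0 (hab j).
pose H j := Q' *m B j *m Q.
pose c m := w (inord m).
pose E := expR (\sum_i ln `|a (w i)|).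
have E0 : 0 < E by exact: expR_gt0.
have prodE : \prod_(0 <= m < n.+1) `|a (c m)| = E.
  rewrite /E expR_sum_ln // big_mkord; apply: eq_bigr => i _.
  by rewrite /c inord_val.
have win i l : (i <= l <= n.+1)%N ->
    \prod_(i <= m < l) `|a (c m)|^-1 ^+ 2 <= expR (2 * K).
  move=> /andP[il lln].
  have hw := hK (inord i) (inord l).
  rewrite !inordK ?ltnS ?(leq_trans il) // in hw.
  have hsum : \sum_(m < n.+1 | (i <= m < l)%N) ln `|a (w m)| =
      \sum_(i <= m < l) ln `|a (c m)|.
    rewrite (big_nat_widen _ _ _ _ _ lln) big_geq_mkord.
    by apply: eq_big => [m|m _]; [rewrite /= andbC|rewrite /c inord_val].
  rewrite hsum -sumrN in hw.
  apply: le_trans (_ : expR (2 * \sum_(i <= m < l) - ln `|a (c m)|) <= _); last first.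
    by rewrite ler_expR ler_wpM2l.
  rewrite mulr_sumr expR_sum le_eqVlt; apply/orP; left; apply/eqP.
  apply: eq_bigr => m _.
  by rewrite mulr_natl mulr2n expRD expRN lnK ?posrE // expr2.
have [P [P0 Pn PS]] := iterate_rec H w.
have hP : P n.+1 = Q' *m iterate B w *m Q by rewrite Pn iterate_conj.
have vec (x0 y0 : R) : `|x0| = 1 -> `|y0| <= 1 ->
  `|P n.+1 1 0 * x0 + P n.+1 1 1 * y0| <=
     2 * expR (2 * K) * `|P n.+1 0 0 * x0 + P n.+1 0 1 * y0| /\
  E / 2 <= `|P n.+1 0 0 * x0 + P n.+1 0 1 * y0| <= 2 * E.
  move=> hx0 hy0; rewrite -prodE.
  pose x m := P m 0 0 * x0 + P m 0 1 * y0.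
  pose y m := P m 1 0 * x0 + P m 1 1 * y0.
  have step m : [/\ x m.+1 = H (c m) 0 0 * x m + H (c m) 0 1 * y m &
      y m.+1 = H (c m) 1 0 * x m + H (c m) 1 1 * y m].
    by rewrite /x /y PS !mul2E -/(c m); split; ring.
  have entry j : [/\ `|H j 0 0 - a j| <= eta, `|H j 0 1| <= eta,
      `|H j 1 0| <= eta & `|H j 1 1 - b j| <= eta].
    have := hB j; rewrite -/(H j); move: (H j) => M hj.
    have e i i' := le_trans (le_sumnorm (M - mx2 (a j) 0 0 (b j)) i i') hj.
    have := e 0 0; have := e 0 1; have := e 1 0; have := e 1 1.
    by rewrite !mxE /= !subr0.
  have comb (s r u v : R) : `|s| <= eta -> `|r| <= eta ->
      `|s * u + r * v| <= eta * (`|u| + `|v|).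
    move=> hs hr; apply: le_trans (ler_normD _ _) _; rewrite !normrM mulrDr.
    by apply: lerD; rewrite ler_wpM2r.
  apply: (@slope_bound _ n.+1 (a \o c) (b \o c) x y eta th (expR (2 * K))) => //=.
  - move=> m _; have [-> _] := step m; have [h1 h2 _ _] := entry (c m).
    by have := comb _ _ (x m) (y m) h1 h2; congr (`|_| <= _); ring.
  - move=> m _; have [_ ->] := step m; have [_ _ h1 h2] := entry (c m).
    by have := comb _ _ (x m) (y m) h1 h2; congr (`|_| <= _); ring.
  - by rewrite /x P0 !mxE /= mul1r mul0r addr0.
  - by rewrite /y P0 !mxE /= mul1r mul0r add0r.
have o0 : 0 < expR (2 * K) by exact: expR_gt0.
have W1 : 1 <= expR (2 * K) by rewrite -expR0 ler_expR mulr_ge0.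
set W := expR (2 * K) in vec o0 W1.
(* The vector [(0, 1)] has infinite slope, so the second column is obtained as the difference of the
   orbits of [(1, 1)] and [(1, 0)]. *)
have := vec 1 0; rewrite normr1 normr0 !mulr1 !mulr0 !addr0 => /(_ erefl ler01).
move=> [v1 /andP[v2 v3]].
have := vec 1 1; rewrite normr1 !mulr1 => /(_ erefl (lexx _)) [v4 /andP[_ v5]].
have lo : E / 2 <= sumnorm (P n.+1) by apply: le_trans v2 (le_sumnorm _ _ _).
(* The first row contributes at most [2 + 4] times [E], the second at most [4 + 8] times [W * E],
   and [W >= 1]. *)
have up : sumnorm (P n.+1) <= 18 * W * E.
  have t0 := ler_normB (P n.+1 0 0 + P n.+1 0 1) (P n.+1 0 0).
  have t1 := ler_normB (P n.+1 1 0 + P n.+1 1 1) (P n.+1 1 0).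
  rewrite [_ + _ - _]addrAC subrr add0r in t0.
  rewrite [_ + _ - _]addrAC subrr add0r in t1.
  have W0 : 0 <= 2 * W by lra.
  have := ler_wpM2l W0 v3; have := ler_wpM2l W0 v5.
  have : E <= W * E by rewrite ler_peMl // ltW.
  by rewrite /sumnorm; lra.
have conj_le (M N L : 'M[R]_2) : sumnorm M <= C -> sumnorm L <= C ->
    sumnorm (M *m N *m L) <= C ^+ 2 * sumnorm N.
  move=> hM hL; apply: le_trans (sumnormM _ _) _.
  have -> : C ^+ 2 * sumnorm N = C * sumnorm N * C by ring.
  apply: ler_pM; rewrite ?sumnorm_ge0 //; apply: le_trans (sumnormM _ _) _.
  by apply: ler_pM; rewrite ?sumnorm_ge0.
have olo : E <= 8 * C ^+ 2 * opnorm (iterate B w).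
  have := conj_le Q' (iterate B w) Q hC' hC; rewrite -hP.
  have := ler_wpM2l (sqr_ge0 C) (sumnorm_le_opnorm (iterate B w)).
  by lra.
have oup : opnorm (iterate B w) <= 18 * C ^+ 2 * W * E.
  apply: le_trans (opnorm_le_sumnorm _) _.
  have -> : iterate B w = Q *m P n.+1 *m Q'.
    have hQ' := mulmx1C hQ.
    by rewrite hP !mulmxA hQ' mul1mx -mulmxA hQ' mulmx1.
  have := conj_le Q (P n.+1) Q' hC hC'.
  by have := ler_wpM2l (sqr_ge0 C) up; lra.
have C2 : 0 < C ^+ 2 by rewrite exprn_gt0.
have op0 : 0 < opnorm (iterate B w).
  by have := lt_le_trans E0 olo; rewrite pmulr_rgt0 // mulr_gt0.
have lnE : ln E = \sum_i ln `|a (w i)| by rewrite /E expRK.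
have lnW : ln W = 2 * K by rewrite /W expRK.
rewrite -lnE -lnW ler_norml; apply/andP; split.
  have : ln E <= ln (18 * C ^+ 2 * opnorm (iterate B w)).
    rewrite ler_ln ?posrE ?mulr_gt0 //; apply: le_trans olo _.
    by rewrite ler_wpM2r ?(ltW op0) // ler_wpM2r ?(ltW C2) //; lra.
  rewrite lnM ?posrE ?mulr_gt0 //.
  by rewrite lnW; lra.
have : ln (opnorm (iterate B w)) <= ln (18 * C ^+ 2 * W * E).
  by rewrite ler_ln ?posrE ?mulr_gt0.
by rewrite lnM ?posrE ?mulr_gt0 // lnM ?posrE ?mulr_gt0 //; lra.
Qed.

End Growth.

(** * Polynomials against exponentials in [q] *)

Section Scales.
Variable R : realType.

Lemma poly_le_expR (m : nat) (C : R) :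
  exists q0 : R, forall q, q0 <= q -> 0 <= q -> C * q ^+ m <= expR q.
Proof.
exists (C * (m.+1)`!%:R) => q hq q0.
have f0 : 0 < (m.+1)`!%:R :> R by rewrite ltr0n fact_gt0.
apply: le_trans (expR_ge1Dxn m q0).
have : C * q ^+ m <= q ^+ m.+1 / (m.+1)`!%:R.
  rewrite ler_pdivlMr // exprS mulrAC ler_wpM2r // exprn_ge0 //.
by lra.
Qed.

(* With [n = q^(20p)], the five bounds serve respectively the Chernoff estimates (with
   parameter [n^(-1/2)] for the full sum and [t] for the windows), the [O(q^2)] error in
   the growth, the comparison of [L_n] with the drift, the smallness of the perturbation
   along an orbit of slope [2 exp (2 q^2)], and the admissibility of [n^(-1/2)]. *)
Lemma scales (p : nat) (C La t : R) : (0 < p)%N -> 1 <= C -> 0 < La -> 0 < t ->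
  exists q0 : R, 1 <= q0 /\ forall q, q0 <= q ->
  [/\ 4 * (q ^+ (20 * p)) ^+ 2 * expR (- (t * q ^+ 2)) +
        2 * expR (8 * La ^+ 2 - q ^+ (6 * p) / 6) <= expR (- q),
      C + 2 * q ^+ 2 <= q ^+ (16 * p) / 6,
      C * expR (- q) <= (q ^+ (4 * p))^-1 / 3,
      C * expR (- q ^+ 20) * (1 + 2 * expR (2 * q ^+ 2)) <=
        (4 * q ^+ (20 * p))^-1 * expR (- La) &
      (q ^+ (10 * p))^-1 * (2 * La) <= 1 / 2].
Proof.
move=> p0 C1 La0 t0.
have t6 : 0 < Num.min t (1 / 6) by rewrite lt_min t0 /=; lra.
pose c := Num.min t (1 / 6).
have ct : c <= t by rewrite ge_min lexx.
have c6 : c <= 1 / 6 by rewrite ge_min lexx orbT.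
have [q1 h1] := poly_le_expR (20 * p * 2) (4 + 2 * expR (8 * La ^+ 2)).
have [q2 h2] := poly_le_expR (4 * p) (3 * C).
have [q3 h3] := poly_le_expR (20 * p) (12 * C * expR La).
(* [2 / c] gives [c * q ^+ 2 >= 2 * q]: one factor [expR (- q)] is the target and the other absorbs
   the prefactor, by [q1]. The entries [6 * (C + 2)], [q2], [q3] and [4 * La] serve the second to
   fifth bounds in this order. *)
exists (Num.max 2 (Num.max (2 / c) (Num.max (6 * (C + 2)) (Num.max (4 * La)
  (Num.max q1 (Num.max q2 q3)))))); split.
  by rewrite le_max; apply/orP; left; lra.
move=> q; rewrite !ge_max => /and5P[g2 gc gC gLa /and3P[g1 g22 g3]].
have q0 : 0 < q by lra.
have q0' := ltW q0.
have q1' : 1 <= q by lra.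
have pw i j : (i <= j)%N -> q ^+ i <= q ^+ j by move=> ij; rewrite ler_weXn2l.
have pp i : 0 < q ^+ i by rewrite exprn_gt0.
split.
- have p1 := pw 2%N (6 * p)%N _; have {}p1 : q ^+ 2 <= q ^+ (6 * p).
    by apply: p1; rewrite (leq_trans _ (leq_mul (leqnn 6) p0)).
  have e1 : expR (- (t * q ^+ 2)) <= expR (- (c * q ^+ 2)).
    by rewrite ler_expR lerN2 ler_wpM2r // ltW.
  have e2 : expR (8 * La ^+ 2 - q ^+ (6 * p) / 6) <=
      expR (8 * La ^+ 2) * expR (- (c * q ^+ 2)).
    rewrite -expRD ler_expR lerD2l lerN2.
    have : c * q ^+ 2 <= 1 / 6 * q ^+ 2 by rewrite ler_wpM2r // ltW.
    by lra.
  have e3 : expR (- (c * q ^+ 2)) <= expR (- q) * expR (- q).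
    rewrite -expRD ler_expR.
    have : 2 <= c * q by rewrite mulrC -ler_pdivrMr.
    by move=> /(ler_wpM2r q0'); rewrite expr2; lra.
  have h := h1 q g1 q0'.
  have N1 : (q ^+ (20 * p)) ^+ 2 = q ^+ (20 * p * 2) by rewrite -exprM.
  have N2 : 1 <= (q ^+ (20 * p)) ^+ 2 by rewrite N1 exprn_ege1.
  set N := (q ^+ (20 * p)) ^+ 2 in N1 N2 *; rewrite -N1 in h.
  set e := expR (- (c * q ^+ 2)) in e1 e2 e3.
  have e0 : 0 < e by exact: expR_gt0.
  have x0 := expR_gt0 (8 * La ^+ 2); set x := expR (8 * La ^+ 2) in h e2 x0.
  apply: (@le_trans _ _ ((4 + 2 * x) * N * e)).
    have N0 : 0 <= 4 * N by lra.
    have := ler_wpM2l N0 e1.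
    have : x * e <= x * e * N by rewrite ler_peMr // mulr_ge0 // ltW.
    by lra.
  have : (4 + 2 * x) * N * e <= expR q * (expR (- q) * expR (- q)).
    by apply: ler_pM => //; [rewrite mulr_ge0 //; lra|exact: ltW].
  by rewrite mulrA -expRD subrr expR0 mul1r.
- have : q ^+ 3 <= q ^+ (16 * p).
    by apply: pw; rewrite (leq_trans _ (leq_mul (leqnn 16) p0)).
  have : 6 * (C + 2) * q ^+ 2 <= q ^+ 3 by rewrite [leRHS]exprS ler_wpM2r // ltW.
  have : 1 <= q ^+ 2 by rewrite exprn_ege1.
  by nra.
- have h := h2 q g22 q0'.
  rewrite expRN ler_pdivrMr ?expR_gt0 // -mulrA ler_pdivlMl //.
  by lra.
- have := h3 q g3 q0' => h.
  have e1 : 2 * q ^+ 2 + q <= q ^+ 20.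
    have : q ^+ 4 <= q ^+ 20 by exact: pw.
    have : q ^+ 4 = q ^+ 2 * q ^+ 2 by rewrite -exprD.
    have : 4 <= q ^+ 2 by rewrite expr2; nra.
    have : q <= q ^+ 2 by rewrite expr2; nra.
    by nra.
  have e2 : expR (- q ^+ 20) <= expR (- (2 * q ^+ 2)) * expR (- q).
    by rewrite -expRD ler_expR; lra.
  have W1 : 1 <= expR (2 * q ^+ 2).
    by rewrite -expR0 ler_expR mulr_ge0 // ltW.
  have WV : expR (- (2 * q ^+ 2)) * expR (2 * q ^+ 2) = 1.
    by rewrite -expRD addNr expR0.
  have e3 : expR (- q ^+ 20) * (1 + 2 * expR (2 * q ^+ 2)) <= 3 * expR (- q).
    have : expR (- q ^+ 20) * (1 + 2 * expR (2 * q ^+ 2)) <=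
      expR (- (2 * q ^+ 2)) * expR (- q) * (3 * expR (2 * q ^+ 2)).
      by apply: ler_pM; rewrite ?expR_ge0 //; lra.
    move=> hh; apply: (le_trans hh).
    have -> : expR (- (2 * q ^+ 2)) * expR (- q) * (3 * expR (2 * q ^+ 2)) =
      expR (- (2 * q ^+ 2)) * expR (2 * q ^+ 2) * (3 * expR (- q)) by ring.
    by rewrite WV mul1r.
  rewrite -mulrA; have C0 : 0 <= C by lra.
  apply: le_trans (ler_wpM2l C0 e3) _.
  rewrite ler_pdivlMl ?mulr_gt0 // !expRN -[leRHS]mul1r ler_pdivlMr ?expR_gt0 //.
  have E0 := expR_gt0 q.
  have -> : 4 * q ^+ (20 * p) * (C * (3 * (expR q)^-1)) * expR La =
    (12 * C * expR La * q ^+ (20 * p)) / expR q by field; rewrite gt_eqF.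
  by rewrite ler_pdivrMr // mul1r.
- rewrite ler_pdivrMl //.
  have : q ^+ 1 <= q ^+ (10 * p).
    by apply: pw; rewrite (leq_trans _ (leq_mul (leqnn 10) p0)).
  by rewrite expr1; lra.
Qed.

End Scales.

(** * Concentration near a diagonal cocycle *)

Section Concentration.
Variables (R : realType) (k : nat) (pr : 'I_k -> R).
Hypotheses (pr_pos : forall j, 0 < pr j) (pr_sum : \sum_(j < k) pr j = 1).

(** The quantifier order is the point: [q0] is fixed from [p], [C], [La], [m0] and [pr] before the
    cocycle and the basis are given. *)
Lemma concentration_near_diagonal (p : nat) (C La m0 : R) :
  (0 < p)%N -> 1 <= C -> 0 < La -> 0 < m0 ->
  exists q0 : R, 1 <= q0 /\ forall (q : R) (n : nat), q0 <= q -> n.+1%:R = q ^+ (20 * p) ->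
  forall (B : cocycle R k) (Q Q' : 'M[R]_2) (a b : 'I_k -> R),
  SL2_cocycle B -> (forall j, sumnorm (B j) <= C) ->
  Q' *m Q = 1%:M -> sumnorm Q <= C -> sumnorm Q' <= C ->
  (forall j, `|a j| * `|b j| = 1) -> (forall j, `|ln `|a j| | <= La) ->
  m0 <= \sum_j pr j * ln `|a j| ->
  (forall j, sumnorm (Q' *m B j *m Q - mx2 (a j) 0 0 (b j)) <= C * expR (- q ^+ 20)) ->
  Prob pr (fun w : {ffun 'I_n.+1 -> 'I_k} =>
     `| n.+1%:R^-1 * ln (opnorm (iterate B w)) - Ln pr B n.+1 | > (q ^+ (4 * p))^-1)
  <= expR (- q).
Proof.
move=> p0 C1 La0 m00.
(* The two entries are the two smallness conditions of [window_mgf_le], with the drift replaced by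
   its lower bound [m0]. *)
pose t := Num.min (1 / (2 * La)) (m0 / (2 * La ^+ 2)).
have La2 : 0 < La ^+ 2 by rewrite exprn_gt0.
have t0 : 0 < t by rewrite lt_min !divr_gt0 // ?mulr_gt0.
have tLa : t * La <= 1 / 2.
  have : t <= 1 / (2 * La) by rewrite ge_min lexx.
  by rewrite ler_pdivlMr ?mulr_gt0 //; lra.
have tm0 : 2 * t * La ^+ 2 <= m0.
  have : t <= m0 / (2 * La ^+ 2) by rewrite ge_min lexx orbT.
  by rewrite ler_pdivlMr ?mulr_gt0 //; lra.
have C2 : 1 <= C ^+ 2 by rewrite exprn_ege1.
have l1 : 0 <= ln (18 * C ^+ 2) by apply: ln_ge0; lra.
have l2 : 0 <= ln C by exact: ln_ge0.
have l3 : 0 <= ln (2 : R) by apply: ln_ge0; lra.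
pose C' := C + ln (18 * C ^+ 2) + ln 2 + ln C + La.
have C'1 : 1 <= C' by rewrite /C'; lra.
have [q0 [q01 hq]] := scales p0 C'1 La0 t0.
exists q0; split => // q n /hq[s1 s2 s3 s4 s5] hn B Q Q' a b hS hB hQ hQC hQ'C hab hLa hm0 hE.
have n0 : 0 < n.+1%:R :> R by rewrite ltr0n.
have qn0 : q != 0.
  apply/eqP => q00; move: n0.
  by rewrite hn q00 expr0n muln_eq0 /= -leqn0 leqNgt p0 ltxx.
have q16 : q ^+ (16 * p) = q ^+ (20 * p) * (q ^+ (4 * p))^-1.
  have -> : (20 * p = 16 * p + 4 * p)%N by rewrite -mulnDl.
  by rewrite exprD mulfK // expf_neq0.
have hnorm : (q ^+ (10 * p)) ^+ 2 = q ^+ (20 * p).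
  by rewrite -exprM mulnAC.
have q4 : 0 < (q ^+ (4 * p))^-1.
  by rewrite invr_gt0 mulnC exprM exprn_even_gt0 // expf_neq0.
have q10 : 0 < q ^+ (10 * p).
  by rewrite mulnC exprM exprn_even_gt0 // expf_neq0.
set mu := \sum_j pr j * ln `|a j|.
have -> : (q ^+ (4 * p))^-1 = 3 * ((q ^+ (4 * p))^-1 / 3) by lra.
have muLa : `|mu| <= La by exact: mean_le.
apply: (@deviation_transfer _ _ _ pr_pos pr_sum n.+1 _
  (regular pr (fun j => ln `|a j|) (q ^+ 2) (q ^+ (16 * p) / 6)) mu C' _ _ _ _ _ _ _ s3).
- by rewrite divr_ge0 // ltW.
- by lra.
- move=> w /andP[/forallP hwin hdev]; rewrite -/mu in hdev.
  have hwin' (i l : 'I_n.+2) : - (\sum_(m < n.+1 | (i <= m < l)%N) ln `|a (w m)|) <= q ^+ 2.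
    by have /forallP := hwin i; apply.
  have hth : n.+1%:R * (4 * q ^+ (20 * p))^-1 <= 1 / 4 :> R.
    rewrite -hn invfM mulrCA mulfV ?gt_eqF //; lra.
  have hth0 : 0 <= (4 * q ^+ (20 * p))^-1 by rewrite -hn invr_ge0 mulr_ge0.
  have hgrow := @ln_opnorm_iterate_near R k n B w Q Q' a b C _ _ _ hQ C1 hQC hQ'C hab hE hwin'
     _ hth0 hth _.
  have {}hgrow : `|ln (opnorm (iterate B w)) - \sum_i ln `|a (w i)| | <=
      ln (18 * C ^+ 2) + 2 * q ^+ 2.
    apply: hgrow; first by rewrite mulr_ge0 ?expR_ge0 //; lra.
    move=> j; apply: le_trans (_ : (4 * q ^+ (20 * p))^-1 * expR (- La) <= _).
      apply: le_trans s4.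
      have x0 : 0 <= 1 + 2 * expR (2 * q ^+ 2) by rewrite addr_ge0 // mulr_ge0 // expR_ge0.
      have CC' : C <= C' by rewrite /C'; lra.
      exact: ler_wpM2r x0 _ _ (ler_wpM2r (expR_ge0 _) CC').
    rewrite ler_wpM2l //.
    have aj : 0 < `|a j|.
      exact: normM1_gt0 (hab j).
    rewrite -[leRHS]lnK ?posrE // ler_expR.
    by have := hLa j; rewrite ler_norml => /andP[].
  have -> : n.+1%:R^-1 * ln (opnorm (iterate B w)) - mu =
    n.+1%:R^-1 * ((ln (opnorm (iterate B w)) - \sum_i ln `|a (w i)|) +
       (\sum_i ln `|a (w i)| - n.+1%:R * mu)).
    by field; rewrite gt_eqF.
  rewrite normrM gtr0_norm ?invr_gt0 // ler_pdivrMl //.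
  apply: le_trans (ler_normD _ _) _.
  have -> : n.+1%:R * ((q ^+ (4 * p))^-1 / 3) = q ^+ (16 * p) / 3 by rewrite q16 -hn mulrA.
  by move: s2; rewrite /C'; lra.
- move=> w; apply: le_trans (ler_normB _ _) _.
  have h := ln_opnorm_iterate_le w C1 hS hB.
  rewrite normrM gtr0_norm ?invr_gt0 //.
  have : n.+1%:R^-1 * `|ln (opnorm (iterate B w))| <= ln 2 + ln C.
    rewrite ler_pdivrMl //; apply: (le_trans h).
    rewrite mulrDr lerD2r ler_peMl // ler1n //.
  by rewrite /C'; move: (_^-1 * _) => X; lra.
- have := @Prob_irregular _ _ _ pr_pos pr_sum (fun j => ln `|a j|) La hLa n.+1
    (q ^+ 2) (q ^+ (16 * p) / 6) (q ^+ (10 * p))^-1 t (ltW t0) tLa (le_trans tm0 hm0) _ s5.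
  rewrite invr_ge0 (ltW q10) => /(_ isT) h; apply: (le_trans h); apply: le_trans s1.
  (* With the inverse square root of the length as parameter, the quadratic term is constant while
     the gain is [q ^+ (6 * p) / 6]. *)
  have e1 : n.+1%:R * (q ^+ (10 * p))^-1 ^+ 2 = 1.
    by rewrite exprVn hnorm -hn mulfV // gt_eqF.
  have e2 : (q ^+ (10 * p))^-1 * (q ^+ (16 * p) / 6) = q ^+ (6 * p) / 6.
    have -> : (16 * p = 10 * p + 6 * p)%N by rewrite -mulnDl.
    by rewrite exprD mulrA mulKf // expf_neq0.
  rewrite e1 e2 mulr1 lerD2r ler_wpM2r ?expR_ge0 // -hn.
  have : n.+2%:R <= 2 * n.+1%:R :> R.
    by rewrite -natrM ler_nat mul2n -addnn addSn ltnS leq_addl.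
  move=> h2; have -> : 4 * n.+1%:R ^+ 2 = (2 * n.+1%:R) ^+ 2 :> R by ring.
  by rewrite ler_sqr ?nnegrE // mulr_ge0.
Qed.

Lemma iterate_diag n (a b : 'I_k -> R) (w : {ffun 'I_n -> 'I_k}) :
  iterate (fun j => mx2 (a j) 0 0 (b j)) w =
  mx2 (\prod_i a (w (rev_ord i))) 0 0 (\prod_i b (w (rev_ord i))).
Proof.
rewrite /iterate.
elim/big_rec3 : _ => [|i x y M _ ->].
  by apply: mx2P; rewrite mx2E !mxE.
by apply: mx2P; rewrite -mulmxE !mul2E !mx2E; ring.
Qed.

(** Here [|ln ||A^(n)|| |] is at most a constant plus [|S_n|], and [|x| <= expR x + expR (- x)] at
    [x = S_n / sqrt n] bounds the mean of [|S_n|] by a multiple of [sqrt n]. So [Ln pr A n] is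
    [O (n^(-1/2))]. *)
Lemma Lyap_eq0 (A : cocycle R k) (P P' : 'M[R]_2) (a b : 'I_k -> R) :
  SL2_cocycle A -> P' *m P = 1%:M ->
  (forall j, P' *m A j *m P = mx2 (a j) 0 0 (b j)) ->
  (forall j, `|a j| * `|b j| = 1) ->
  \sum_j pr j * ln `|a j| = 0 -> Lyap pr A = 0.
Proof.
move=> hS hP hA hab hmu.
have a0 j : 0 < `|a j| := normM1_gt0 (hab j).
have lb j : `|b j| = `|a j|^-1 by exact: normM1_V.
pose La := \sum_j `|ln `|a j| |.
have hLa j : `|ln `|a j| | <= La.
  by rewrite /La (bigD1 j) //= lerDl sumr_ge0.
have La0 : 0 <= La by rewrite sumr_ge0.
pose C := 1 + sumnorm P + sumnorm P'.
have C1 : 1 <= C by rewrite /C; have := sumnorm_ge0 P; have := sumnorm_ge0 P'; lra.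
have C21 : 1 <= C ^+ 2 by rewrite exprn_ege1.
have l2 : 0 <= ln (2 : R) by apply: ln_ge0; lra.
pose c1 := ln (2 * C ^+ 2) + ln 2.
have c10 : 0 <= c1 by rewrite addr_ge0 //; apply: ln_ge0; lra.
have hop n (w : {ffun 'I_n -> 'I_k}) :
    `|ln (opnorm (iterate A w))| <= c1 + `|\sum_i ln `|a (w i)| |.
  set S := \sum_i _.
  have o2 := opnorm_SL2 (iterate_SL2 w hS).
  have it : iterate A w = P *m iterate (fun j => mx2 (a j) 0 0 (b j)) w *m P'.
    have -> : (fun j => mx2 (a j) 0 0 (b j)) = (fun j => P' *m A j *m P).
      by apply/funext => j; rewrite hA.
    rewrite iterate_conj // !mulmxA (mulmx1C hP) mul1mx -mulmxA (mulmx1C hP) mulmx1 //.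
  have pa : `|\prod_i a (w (rev_ord i))| = expR S.
    rewrite normr_prod /S expR_sum_ln // [RHS](reindex_inj rev_ord_inj) //.
  have pb : `|\prod_i b (w (rev_ord i))| = expR (- S).
    rewrite normr_prod expRN /S expR_sum_ln // -prodfV [RHS](reindex_inj rev_ord_inj) /=.
    by apply: eq_bigr => i _; rewrite lb.
  have nD : sumnorm (iterate (fun j => mx2 (a j) 0 0 (b j)) w) <= 2 * expR `|S|.
    rewrite iterate_diag /sumnorm !mx2E normr0 pa pb.
    have : expR S <= expR `|S| by rewrite ler_expR ler_norm.
    have : expR (- S) <= expR `|S| by rewrite ler_expR -normrN ler_norm.
    by lra.
  have up : opnorm (iterate A w) <= 2 * C ^+ 2 * expR `|S|.
    apply: le_trans (opnorm_le_sumnorm _) _; rewrite it.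
    apply: le_trans (sumnormM _ _) _.
    have -> : 2 * C ^+ 2 * expR `|S| = C * (2 * expR `|S|) * C by ring.
    apply: ler_pM; rewrite ?sumnorm_ge0 //; last by rewrite /C; have := sumnorm_ge0 P; lra.
    apply: le_trans (sumnormM _ _) _.
    by apply: ler_pM; rewrite ?sumnorm_ge0 // /C; have := sumnorm_ge0 P'; lra.
  have o0 : 0 < opnorm (iterate A w) by lra.
  have c2 : 0 <= ln (2 * C ^+ 2) by apply: ln_ge0; lra.
  rewrite ler_norml /c1; apply/andP; split.
    have : ln (1 / 2) <= ln (opnorm (iterate A w)) by rewrite ler_ln ?posrE //; lra.
    by rewrite mul1r lnV ?posrE //; have := normr_ge0 S; lra.
  have c0 : 0 < 2 * C ^+ 2 by lra.
  have := up; rewrite -ler_ln ?posrE ?(mulr_gt0 c0) ?expR_gt0 //.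
  rewrite lnM ?posrE ?expR_gt0 // expRK.
  by lra.
pose c2 := c1 + 2 * expR (8 * La ^+ 2).
have c20 : 0 < c2 by rewrite /c2; have := expR_gt0 (8 * La ^+ 2); lra.
have bound n : (0 < n)%N -> 4 * La <= Num.sqrt n%:R ->
    `|Ln pr A n| <= c2 / Num.sqrt n%:R.
  move=> n0 hn; set r := Num.sqrt n%:R in hn *.
  have nr0 : 0 < n%:R :> R by rewrite ltr0n.
  have r0 : 0 < r by rewrite sqrtr_gt0.
  have rr : r ^+ 2 = n%:R by rewrite sqr_sqrtr // ltW.
  have r1 : 1 <= r by rewrite -[1]sqrtr1 ler_wsqrtr // ler1n.
  apply: le_trans (norm_Expect_le pr_pos _) _.
  apply: (@le_trans _ _ (Expect pr (fun w : {ffun 'I_n -> 'I_k} =>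
     n%:R^-1 * (c1 + r * (expR (r^-1 * (\sum_i ln `|a (w i)| - n%:R * \sum_j pr j * ln `|a j|)) +
       expR (- r^-1 * (\sum_i ln `|a (w i)| - n%:R * \sum_j pr j * ln `|a j|))))))).
    apply: (Expect_le pr_pos) => w; rewrite normrM gtr0_norm ?invr_gt0 //.
    rewrite ler_wpM2l ?invr_ge0 //; apply: le_trans (hop _ _) _.
    rewrite lerD2l hmu mulr0 subr0; set S := \sum_i _.
    have e1 := expR_ge1Dx (r^-1 * S); have e2 := expR_ge1Dx (- r^-1 * S).
    have p1 := expR_ge0 (r^-1 * S); have p2 := expR_ge0 (- r^-1 * S).
    rewrite mulrC -ler_pdivrMr // mulrC.
    have : `|r^-1 * S| <= expR (r^-1 * S) + expR (- r^-1 * S).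
      by rewrite ler_norml; lra.
    by rewrite normrM gtr0_norm ?invr_gt0.
  rewrite ExpectZ (ExpectD _ (fun=> c1)) (Expect_cst pr_sum) ExpectZ ExpectD.
  have hs : `|r^-1| * (2 * La) <= 1 / 2.
    by rewrite gtr0_norm ?invr_gt0 // ler_pdivrMl //; lra.
  have m1 := @sum_mgf_le _ _ _ pr_pos pr_sum (fun j => ln `|a j|) La hLa n r^-1 hs.
  have m2 := @sum_mgf_le _ _ _ pr_pos pr_sum (fun j => ln `|a j|) La hLa n (- r^-1).
  rewrite normrN in m2; have {}m2 := m2 hs.
  have e1 : n%:R * r^-1 ^+ 2 = 1 by rewrite exprVn rr mulfV // gt_eqF.
  rewrite sqrrN e1 mulr1 in m2; rewrite e1 mulr1 in m1.
  rewrite -rr ler_pdivrMl ?exprn_gt0 //.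
  have -> : r ^+ 2 * (c2 / r) = r * c2 by field; rewrite gt_eqF.
  have : c1 <= r * c1 by rewrite ler_peMl.
  rewrite rr /c2.
  have := ler_wpM2l (ltW r0) (lerD m1 m2).
  by lra.
apply: cvg_lim => //; apply/cvgrPdist_le => e e0.
(* Past this rank [sqrt n] exceeds [4 * La], as the moment bound requires, and [c2 / e], which makes
   the estimate smaller than [e]. *)
exists (Num.bound ((4 * La + c2 / e) ^+ 2)).+1 => // n /= hn.
have n0 : (0 < n)%N by apply: leq_ltn_trans hn.
have x0 : 0 <= 4 * La + c2 / e by rewrite addr_ge0 ?mulr_ge0 ?invr_ge0 // ltW.
have hr : 4 * La + c2 / e <= Num.sqrt n%:R.
  rewrite -[leLHS]ger0_norm // -sqrtr_sqr ler_wsqrtr //.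
  apply: le_trans (ltW (archi_boundP (sqr_ge0 _))) _.
  by rewrite ler_nat ltnW.
have ce : 0 < c2 / e by rewrite divr_gt0.
rewrite sub0r normrN; apply: le_trans (bound n n0 _) _; first by lra.
have r0 : 0 < Num.sqrt n%:R :> R by apply: lt_le_trans hr; lra.
by rewrite ler_pdivrMr // -ler_pdivrMl // mulrC; lra.
Qed.

End Concentration.

(** * Uniformity over the diagonal cocycles near A *)

Section Uniformity.
Variables (R : realType) (k : nat) (pr : 'I_k -> R).
Hypotheses (pr_pos : forall j, 0 < pr j) (pr_sum : \sum_(j < k) pr j = 1).

(** Zero drift is excluded by [Lyap_eq0]; if the drift is negative, the swap [J] of the axes
    replaces [a] by [b], and [ln |b| = - ln |a|]. *)
Lemma Diag_positive_exponent (A : cocycle R k) : Diag k A -> 0 < Lyap pr A ->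
  exists (P P' : 'M[R]_2) (a b : 'I_k -> R), [/\ P' *m P = 1%:M,
    (forall j, P' *m A j *m P = mx2 (a j) 0 0 (b j)),
    (forall j, `|a j| * `|b j| = 1) & 0 < \sum_j pr j * ln `|a j|].
Proof.
move=> hA hL; have [P [P' [a [b [hP hd hab]]]]] := Diag_diagonalize hA.
have [mu0|mu0|mu0] := ltgtP 0 (\sum_j pr j * ln `|a j|).
- by exists P, P', a, b.
- pose J : 'M[R]_2 := mx2 0 1 1 0.
  have JJ : J *m J = 1%:M by apply: mx2P; rewrite !mul2E !mxE /=; ring.
  exists (P *m J), (J *m P'), b, a; split => [|j|j|].
  + by rewrite mulmxA -(mulmxA J) hP mulmx1.
  + have -> : J *m P' *m A j *m (P *m J) = J *m (P' *m A j *m P) *m J by rewrite !mulmxA.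
    by rewrite hd; apply: mx2P; rewrite !mul2E !mx2E; ring.
  + by rewrite mulrC.
  + rewrite -oppr_lt0 -sumrN; apply: le_lt_trans mu0; apply: ler_sum => j _.
    have a0 : 0 < `|a j|.
      exact: normM1_gt0 (hab j).
    have -> : `|b j| = `|a j|^-1.
      exact: normM1_V.
    by rewrite lnV ?posrE // mulrN opprK.
- by move: hL; rewrite (Lyap_eq0 pr_pos pr_sum hA.1 hP hd hab (esym mu0)) ltxx.
Qed.

Lemma pos_lower_bound (f : 'I_k -> R) : (forall j, 0 < f j) ->
  exists2 e, 0 < e & forall j, e <= f j.
Proof.
move=> f0; exists (\big[Num.min/1]_(j < k) f j); last by move=> j; exact: bigmin_le.
by elim/big_ind : _ => // x y x0 y0; rewrite lt_min x0.
Qed.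

(** The upper side uses [2 - expR (- h) <= expR h]. *)
Lemma ln_norm_near (x y h : R) : 0 < `|x| -> `|y - x| <= `|x| * (1 - expR (- h)) ->
  `|ln `|y| - ln `|x| | <= h.
Proof.
move=> x0 hxy; have r0 := expR_gt0 (- h).
have lo : `|x| * expR (- h) <= `|y|.
  by have := ler_normB y (y - x); rewrite opprB addrC subrK; lra.
have y0 : 0 < `|y| by apply: lt_le_trans lo; rewrite mulr_gt0.
have up : `|y| <= `|x| * expR h.
  have := ler_normD (y - x) x; rewrite subrK => hy.
  apply: le_trans (_ : `|x| * (2 - expR (- h)) <= _); first by lra.
  by rewrite ler_wpM2l //; have := expR_ge1Dx h; have := expR_ge1Dx (- h); lra.
rewrite ler_norml; apply/andP; split.
  have : ln (`|x| * expR (- h)) <= ln `|y| by rewrite ler_ln ?posrE ?mulr_gt0.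
  by rewrite lnM ?posrE // expRK; lra.
have : ln `|y| <= ln (`|x| * expR h) by rewrite ler_ln ?posrE ?mulr_gt0 ?expR_gt0.
by rewrite lnM ?posrE ?expR_gt0 // expRK; lra.
Qed.

(** A nonzero drift provides a letter with [|a j0| != 1], which anchors the invariant lines of every
    nearby [D]. Taking [D] close enough to move each [ln |a j|] by at most [mu / 2] preserves half
    of the drift. *)
Lemma Diag_uniform_basis (A : cocycle R k) : Diag k A -> 0 < Lyap pr A ->
  exists d C La m0 : R, [/\ 0 < d, 1 <= C, 0 < La, 0 < m0 &
  forall D : cocycle R k, Diag k D -> (forall j, sumnorm (D j - A j) <= d) ->
  exists (Q Q' : 'M[R]_2) (a b : 'I_k -> R),
    [/\ Q' *m Q = 1%:M, sumnorm Q <= C /\ sumnorm Q' <= C,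
      m0 <= \sum_j pr j * ln `|a j| &
      forall j, [/\ Q' *m D j *m Q = mx2 (a j) 0 0 (b j),
        `|a j| * `|b j| = 1 & `|ln `|a j| | <= La]]].
Proof.
move=> hA hL; have [P [P' [a [b [hP hd hab hmu]]]]] := Diag_positive_exponent hA hL.
set mu := \sum_j _ in hmu.
have a0 j : 0 < `|a j| := normM1_gt0 (hab j).
have [j0 hj0] : exists j0, `|a j0| != 1.
  apply/not_existsP => h.
  suff : mu = 0 by move=> h0; rewrite h0 ltxx in hmu.
  by apply: big1 => j _; have := h j => /negP; rewrite negbK => /eqP ->; rewrite ln1 mulr0.
have hb0 : `|b j0| != 1.
  by apply: contra hj0 => /eqP hb; have := hab j0; rewrite hb mulr1 => ->.
have ga : 0 < `| `|a j0| ^+ 2 - 1|.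
  by rewrite normr_gt0 subr_eq0 -[X in _ != X](expr1n _ 2) eqrXn2.
have gb : 0 < `| `|b j0| ^+ 2 - 1|.
  by rewrite normr_gt0 subr_eq0 -[X in _ != X](expr1n _ 2) eqrXn2.
have gab : 0 < `|a j0 - b j0|.
  rewrite normr_gt0 subr_eq0; apply: contra hj0 => /eqP h.
  by have := hab j0; rewrite -h -expr2 => /eqP; rewrite -[X in _ == X](expr1n _ 2) eqrXn2.
have [e1 e10 he1] : exists2 e, 0 < e &
    forall j, e <= `|a j| * (1 - expR (- (mu / 2))).
  apply: pos_lower_bound => j; rewrite mulr_gt0 // subr_gt0 -expR0 ltr_expR.
  by rewrite oppr_lt0 divr_gt0.
have pa : 0 < 2 * (2 * `|a j0| + 1) by have := a0 j0; lra.
have pb : 0 < 2 * (2 * `|b j0| + 1) by have := normr_ge0 (b j0); lra.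
(* The entries before [e1] are the gap conditions of [hyperbolic_eigenbasis] at [j0], the extra
   factor 2 making two of them strict; [e1] controls the change of the logarithms. *)
pose e := Num.min 1 (Num.min (`|a j0 - b j0| / 10)
  (Num.min (`| `|a j0| ^+ 2 - 1| / (2 * (2 * `|a j0| + 1)))
  (Num.min (`| `|b j0| ^+ 2 - 1| / (2 * (2 * `|b j0| + 1))) e1))).
have e0 : 0 < e by rewrite /e !lt_min ltr01 !divr_gt0.
have : e <= e by [].
rewrite {2}/e !le_min => /and5P[le1 leab lea leb lee1].
have hea : e * (2 * `|a j0| + 1) < `| `|a j0| ^+ 2 - 1|.
  by move: lea; rewrite ler_pdivlMr //; lra.
have heb : e * (2 * `|b j0| + 1) < `| `|b j0| ^+ 2 - 1|.
  by move: leb; rewrite ler_pdivlMr //; lra.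
clearbody e.
pose cP := sumnorm P' * sumnorm P.
have cP0 : 0 <= cP by rewrite mulr_ge0 ?sumnorm_ge0.
have sP := sumnorm_ge0 P; have sP' := sumnorm_ge0 P'.
pose La := \sum_j `|ln `|a j| | + mu.
have hLa j : `|ln `|a j| | <= \sum_j `|ln `|a j| | by rewrite (bigD1 j) //= lerDl sumr_ge0.
have La0 : 0 < La by rewrite /La ltr_wpDl // sumr_ge0.
(* Conjugation by [P] inflates distances by at most [cP], and 4 and 8 are the bounds on [G] and
   [G']. *)
exists (e / (cP + 1)), (1 + 4 * sumnorm P + 8 * sumnorm P'), La, (mu / 2).
split => //; try by [lra | rewrite divr_gt0 //; lra].
move=> D hD hDA; have [hDS [u [v [huv heig]]]] := hD.
pose H j := P' *m D j *m P.
have PP := mulmx1C hP.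
have hH j : sumnorm (H j - mx2 (a j) 0 0 (b j)) <= e.
  have -> : H j - mx2 (a j) 0 0 (b j) = P' *m (D j - A j) *m P.
    by rewrite -hd mulmxBr mulmxBl.
  apply: le_trans (sumnormM _ _) _.
  apply: le_trans (ler_wpM2r sP (sumnormM _ _)) _.
  rewrite mulrAC -/cP.
  apply: le_trans (ler_wpM2l cP0 (hDA j)) _.
  rewrite mulrCA ler_piMr ?(ltW e0) // ler_pdivrMr; lra.
have dPP : \det P' * \det P = 1 by rewrite -det_mulmx hP det1.
have dP' : \det P' != 0.
  by apply/eqP => h; move: dPP; rewrite h mul0r => /esym/eqP; rewrite oner_eq0.
have hHS j : SL2 (H j).
  by have := hDS j; rewrite /SL2 /H !det_mulmx mulrAC dPP mul1r.
have huv' : \det (row_mx (P' *m u) (P' *m v)) != 0.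
  by rewrite -mul_mx_row det_mulmx mulf_neq0.
have Heig (y : 'cV[R]_2) j l : D j *m y = l *: y -> H j *m (P' *m y) = l *: (P' *m y).
  move=> h; rewrite /H -!mulmxA (mulmxA P) PP mul1mx h scalemxAr //.
have hu' j : exists l, H j *m (P' *m u) = l *: (P' *m u).
  by have [[l hl] _] := heig j; exists l; exact: Heig.
have hv' j : exists l, H j *m (P' *m v) = l *: (P' *m v).
  by have [_ [l hl]] := heig j; exists l; exact: Heig.
have e01 : 0 < e <= 1 by rewrite e0.
have leab' : 10 * e <= `|a j0 - b j0| by lra.
have [G [G' [a' [b' [hG nG nG' hG2]]]]] :=
  hyperbolic_eigenbasis hH hHS huv' hu' hv' e01 leab' hea heb.
have ln_near j : `|ln `|a' j| - ln `|a j| | <= mu / 2.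
  have [_ _ hj] := hG2 j; apply: ln_norm_near => //.
  exact: le_trans hj (le_trans lee1 (he1 j)).
exists (P *m G), (G' *m P'), a', b'; split => //.
- by rewrite mulmxA -(mulmxA G') hP mulmx1.
- split.
    by apply: le_trans (sumnormM _ _) _; have := ler_wpM2l sP nG; lra.
  by apply: le_trans (sumnormM _ _) _; have := ler_wpM2r sP' nG'; lra.
- have : \sum_j pr j * (ln `|a j| - mu / 2) <= \sum_j pr j * ln `|a' j|.
    apply: ler_sum => j _; rewrite ler_wpM2l ?(ltW (pr_pos j)) //.
    by have := ln_near j; rewrite ler_norml => /andP[]; lra.
  rewrite (eq_bigr (fun j => pr j * ln `|a j| - pr j * (mu / 2))); last first.
    by move=> j _; rewrite mulrBr.
  by rewrite big_split /= sumrN -mulr_suml pr_sum -/mu; lra.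
- move=> j; have [h1 h2 h3] := hG2 j; split => //.
    by rewrite -h1 /H !mulmxA.
  have := ler_normD (ln `|a' j| - ln `|a j|) (ln `|a j|); rewrite subrK /La.
  by have := ln_near j; have := hLa j; lra.
Qed.

Lemma distDiag_ge0 (B : cocycle R k) : 0 <= distDiag B.
Proof.
have [[x hx]|h] := pselect ([set cdist B D | D in @Diag R k] !=set0); last first.
  by rewrite /distDiag (_ : [set _ | _ in _] = set0) ?inf0 // -subset0 => x hx; apply: h; exists x.
by apply: lb_le_inf; [exists x|move=> _ [D _ <-]; exact: cdist_ge0].
Qed.

Lemma distDiag_approx (A B : cocycle R k) (e : R) : Diag k A -> 0 < e ->
  exists2 D, Diag k D & cdist B D < distDiag B + e.
Proof.
move=> hA e0; have [|_ [D hD <-] h] := @inf_adherent R [set cdist B D | D in @Diag R k] e e0.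
  split; first by exists (cdist B A), A.
  by exists 0 => _ [D _ <-]; exact: cdist_ge0.
by exists D.
Qed.

Lemma distDiag_le (A B : cocycle R k) : Diag k A -> distDiag B <= cdist B A.
Proof.
move=> hA; apply: ge_inf; last by exists A.
by exists 0 => _ [D _ <-]; exact: cdist_ge0.
Qed.

End Uniformity.

(** * Assembly of the constants *)

Theorem theorem6p3 (R : realType) (k : nat) (pr : 'I_k -> R)
  (pr_pos : forall j, 0 < pr j) (pr_sum : \sum_(j < k) pr j = 1)
  (A : cocycle R k) (hA : Diag k A) (hLA : 0 < Lyap pr A)
  (p : nat) (hp : (0 < p)%N) :
  exists (delta : R) (nbar : nat), 0 < delta /\
    forall B : cocycle R k, SL2_cocycle B -> cdist B A <= delta ->
    forall n : nat, (nbar <= n)%N ->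
      (distDiag B = 0 \/ n%:R <= (ln (distDiag B)^-1) ^+ p) ->
      Prob pr (fun w : {ffun 'I_n -> 'I_k} =>
                 `| n%:R^-1 * ln (opnorm (iterate B w)) - Ln pr B n |
                   > n%:R `^ (- (5%:R^-1)))
        <= expR (- (n%:R `^ ((20 * p)%:R^-1))).
Proof.
have [d [C [La [m0 [d0 C1 La0 m00 hunif]]]]] := Diag_uniform_basis pr_pos pr_sum hA hLA.
pose CA := \sum_j sumnorm (A j).
have CA0 : 0 <= CA by apply: sumr_ge0 => j _; exact: sumnorm_ge0.
have hCA j : sumnorm (A j) <= CA.
  by rewrite /CA (bigD1 j) //= lerDl sumr_ge0 // => i _; exact: sumnorm_ge0.
(* [8 * C ^+ 2] is the cost of conjugating the perturbation [8 * ex]; [CA + 4] bounds the matrices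
   of [B]. *)
pose C' := 8 * C ^+ 2 + CA + 4.
have CC : C <= C ^+ 2 by rewrite expr2 ler_peMl //; lra.
have C'1 : 1 <= C' by rewrite /C'; lra.
have [q0 [q01 hcore]] := concentration_near_diagonal pr_pos pr_sum hp C'1 La0 m00.
(* [d / 8] leaves [d / 2] for the distance from [B] to [D], since [sumnorm] is at most 4 times the
   operator norm. The entry [1 / 2] makes [ln (distDiag B)^-1] nonnegative when [distDiag B] is
   positive, so that the [p]-th root can be taken. *)
pose delta := Num.min (d / 8) (1 / 2).
have delta0 : 0 < delta by rewrite lt_min divr_gt0 //=; lra.
have dd : delta <= d / 8 by rewrite ge_min lexx.
have d2 : delta <= 1 / 2 by rewrite ge_min lexx orbT.
(* [16 / d <= q <= expR (q ^+ 20)] gives [8 * ex <= d / 2]. *)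
pose q1 := Num.max q0 (16 / d).
have q11 : 1 <= q1 by rewrite le_max q01.
exists delta, (Num.bound (q1 ^+ (20 * p))).+1; split => // B hB hBA n hn hdist.
case: n hn hdist => // n hn hdist.
have p20 : (0 < 20 * p)%N by rewrite muln_gt0.
have p20r : (20 * p)%:R != 0 :> R by rewrite pnatr_eq0 -lt0n.
set q := n.+1%:R `^ (20 * p)%:R^-1.
have q0' : 0 <= q by exact: powR_ge0.
have hq : n.+1%:R = q ^+ (20 * p).
  by rewrite -powR_mulrn // /q -powRrM mulVf // powRr1.
have q1q : q1 <= q.
  rewrite -(ler_pXn2r p20) ?nnegrE //; last by lra.
  rewrite -hq; apply: le_trans (ltW (archi_boundP _)) _; last by rewrite ler_nat ltnW.
  by rewrite exprn_ge0 //; lra.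
have q0q : q0 <= q by apply: le_trans q1q; rewrite le_max lexx.
have qd : 16 / d <= q by apply: le_trans q1q; rewrite le_max lexx orbT.
have h5 : n.+1%:R `^ (- 5%:R^-1) = (q ^+ (4 * p))^-1.
  rewrite powRN; congr (_^-1); rewrite -powR_mulrn // /q -powRrM; congr (_ `^ _).
  rewrite !natrM; have : p%:R != 0 :> R by rewrite pnatr_eq0 -lt0n.
  by move=> ?; field.
rewrite h5; set ex := expR (- q ^+ 20).
have ex0 : 0 < ex by exact: expR_gt0.
have hdd : distDiag B <= ex.
  have eps0 := distDiag_ge0 B.
  have [->|epsn] := eqVneq (distDiag B) 0; first exact: ltW.
  case: hdist => [h|]; first by rewrite h eqxx in epsn.
  have eps1 : 0 < distDiag B by rewrite lt_def epsn.
  have epsl : distDiag B <= 1 / 2.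
    by apply: le_trans (distDiag_le B hA) _; lra.
  rewrite lnV ?posrE // hq exprM ler_pXn2r ?nnegrE ?exprn_ge0 //; last first.
    by rewrite oppr_ge0; apply: ln_le0; lra.
  by move=> h; rewrite -[leLHS]lnK ?posrE // ler_expR; lra.
(* The slack [ex] replaces attainment of the infimum and covers [distDiag B = 0] as well; [D] is
   then within [2 * ex] of [B]. *)
have [D hD hBD] := distDiag_approx B hA ex0.
have hBDj j : sumnorm (B j - D j) <= 8 * ex.
  apply: le_trans (sumnorm_le_opnorm _) _.
  by have := opnorm_le_cdist B D j; lra.
have hBAj j : sumnorm (B j - A j) <= 4 * delta.
  apply: le_trans (sumnorm_le_opnorm _) _.
  by have := opnorm_le_cdist B A j; lra.
have exd : 8 * ex <= d / 2.
  have : q <= q ^+ 20 by rewrite -[leLHS]expr1 ler_weXn2l //; lra.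
  move=> q20; have h1 := expR_ge1Dx (q ^+ 20).
  have h2 : 16 / d <= expR (q ^+ 20) by lra.
  rewrite ler_pdivrMr // in h2.
  have : ex * expR (q ^+ 20) = 1 by rewrite -expRD addNr expR0.
  by have := ler_wpM2l (ltW ex0) h2; nra.
have hDA j : sumnorm (D j - A j) <= d.
  have -> : D j - A j = - (B j - D j) + (B j - A j) by rewrite opprB addrA subrK.
  apply: le_trans (sumnormD _ _) _; rewrite sumnormN.
  by have := hBDj j; have := hBAj j; lra.
have [Q [Q' [a [b [hQ [hQC hQ'C] hm0 hj]]]]] := hunif D hD hDA.
apply: (hcore q n q0q hq B Q Q' a b) => // [j|||j|j|j].
- have -> : B j = (B j - A j) + A j by rewrite subrK.
  apply: le_trans (sumnormD _ _) _; have := hBAj j; have := hCA j.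
  by have := sqr_ge0 C; rewrite /C'; lra.
- by have := sqr_ge0 C; rewrite /C'; lra.
- by have := sqr_ge0 C; rewrite /C'; lra.
- by have [] := hj j.
- by have [] := hj j.
- have [<- _ _] := hj j.
  have -> : Q' *m B j *m Q - Q' *m D j *m Q = Q' *m (B j - D j) *m Q.
    by rewrite mulmxBr mulmxBl.
  apply: le_trans (_ : C * (8 * ex) * C <= _); last first.
    have -> : C * (8 * ex) * C = 8 * C ^+ 2 * ex by ring.
    by rewrite ler_wpM2r ?(ltW ex0) // /C'; lra.
  apply: le_trans (sumnormM _ _) _; apply: ler_pM; rewrite ?sumnorm_ge0 //.
  apply: le_trans (sumnormM _ _) _; apply: ler_pM; rewrite ?sumnorm_ge0 //.
Qed.
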